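(* Let $S$ be a linear relation in $\mathbb C^m$ with Weyr characteristic $(W,A,B,C)$. Suppose there exist matrices $E,F\in\mathbb C^{n\times m}$ such that the kernel representation $E^{-1}F:=\{(x,y)\in\mathbb C^m\times\mathbb C^m: Fx=Ey\}$ of the matrix pencil $P(s)=sE-F$ coincides with $S$. Then the Weyr characteristic $(w,a,b,c)$ of the pencil $P(s)$ is given by $$w=W,\qquad a=A,\qquad b=B,$$ and, if $C=(C_1,\ldots,C_{n_C})$, then $$c=\big(n-m+B_1,\ m-|W|-|A|-|B|-|C|,\ C_1,C_2,C_3,\ldots,C_{n_C}\big).$$
   Context: **Linear relations.** A linear relation in a finite-dimensional complex vector space $X$ is a linear subspace $S$ of $X\times X$. Put $\operatorname{dom}S=\{x:(x,y)\in S \text{ for some }y\}$, $R(S)=\{y:(x,y)\in S\text{ for some }x\}$, $N(S)=\{x:(x,0)\in S\}$, $\operatorname{mul}(S)=\{y:(0,y)\in S\}$, $S-\lambda=\{(x,y-\lambda x):(x,y)\in S\}$ for $\lambda\in\mathbb C$. The product is $S_1S_2=\{(x,z): (x,y)\in S_2,\ (y,z)\in S_1\text{ for some }y\}$; $S^0=I$ is the identity relation and $S^k=S\cdot S^{k-1}$. For $\lambda\in\mathbb C$ let $\mathcal R_\lambda(S)=\bigcup_{k}N((S-\lambda)^k)$, $\mathcal R_\infty(S)=\bigcup_k\operatorname{mul}(S^k)$, and $\mathcal R_c(S)=\mathcal R_0(S)\cap\mathcal R_\infty(S)$. A number $\lambda\in\mathbb C$ is an eigenvalue of $S$ if $N(S-\lambda)\ne\{0\}$,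 and $\infty$ is an eigenvalue if $\operatorname{mul}(S)\neq\{0\}$; an eigenvalue $\lambda\in\mathbb C\cup\{\infty\}$ is proper if $\mathcal R_\lambda(S)\not\subset\mathcal R_c(S)$. **Weyr characteristic of a linear relation.** For $k\ge1$ and $\lambda\in\mathbb C$ set $$W_k(S,\lambda)=\dim\frac{N((S-\lambda)^k)+\mathcal R_c(S)}{N((S-\lambda)^{k-1})+\mathcal R_c(S)},\quad A_k=\dim\frac{\operatorname{mul}(S^k)+\mathcal R_c(S)}{\operatorname{mul}(S^{k-1})+\mathcal R_c(S)},\quad B_k=\dim\frac{N(S^k)\cap\mathcal R_c(S)}{N(S^{k-1})\cap\mathcal R_c(S)},$$ $$C_1=\dim\frac{R(S)+\operatorname{dom}S}{R(S)+\mathcal R_0(S)},\qquad C_k=\dim\frac{R(S^{k})+\mathcal R_0(S)}{R(S^{k+1})+\mathcal R_0(S)}\quad(k\ge2).$$ These sequences are non-increasing and eventually zero; they are regarded as finite sequences by omitting zero entries (possibly empty). $W$ is the collection of the sequences $W(\lambda)=(W_k(S,\lambda))_k$ indexed by the finite proper eigenvalues $\lambda$ of $S$, and $(W,A,B,C)$ with $A=(A_k)$, $B=(B_k)$, $C=(C_k)$ is the Weyr characteristic of $S$. **Weyr characteristic of a pencil.** For $k\ge1$ let $N_k\in\mathbb C^{k\times k}$ have ones on the first subdiagonal and zeros elsewhere, and let $K_k=[I_{k-1}\ 0]$, $L_k=[0\ I_{k-1}]\in\mathbb C^{(k-1)\times k}$ (for $k=1$ these are $0\times1$ matrices, contributing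 just a zero column to a block diagonal matrix, and their transposes contribute just a zero row). For a multi-index $\alpha=(\alpha_1,\dots,\alpha_l)$ of positive integers, $|\alpha|=\sum_i\alpha_i$ and $N_\alpha,K_\alpha,L_\alpha$ are the block diagonal matrices with blocks $N_{\alpha_i},K_{\alpha_i},L_{\alpha_i}$. Every pencil $sE-F$ with $E,F\in\mathbb C^{n\times m}$ admits invertible $V\in\mathbb C^{n\times n}$, $U\in\mathbb C^{m\times m}$ with $$V(sE-F)U=\operatorname{diag}\big(sI_{n_0}-J_0,\ sN_\alpha-I_{|\alpha|},\ sK_\beta-L_\beta,\ sK_\gamma^\top-L_\gamma^\top\big)$$ (Kronecker canonical form), where $J_0$ is in Jordan normal form and $\alpha,\beta,\gamma$ are non-increasing multi-indices (any block may be absent), unique up to permutation of the Jordan blocks of $J_0$. The Weyr characteristic $w(P)=(w,a,b,c)$ is: $w$ is the collection, indexed by the eigenvalues $\lambda$ of $J_0$, of the sequences $w(\lambda)=(w_k(\lambda))_k$, $w_k(\lambda)=\dim N((J_0-\lambda)^k)-\dim N((J_0-\lambda)^{k-1})$; $a,b,c$ are the conjugate partitions of $\alpha,\beta,\gamma$, i.e. $a_k=\#\{i:\alpha_i\ge k\}$, and similarly for $b,c$ (zero entries omitted). The equality $w=W$ means that the finite proper eigenvalues of the relation are the eigenvalues of $J_0$ and that the sequences at each of them agree. **Further conventions.** $|W|$, $|A|$, $|B|$, $|C|$ denote the sums of all entries of the respective sequences (for $W$: over all finite proper eigenvalues). $B_1:=0$ if $B$ is empty. Zero entries at the end of the displayed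 formula for $c$ are omitted. *)

(* Defs.v *)
From HB Require Import structures.
From mathcomp Require Import all_boot all_order all_algebra.
From mathcomp Require Import classical_sets fsbigop.

Set Implicit Arguments.
Unset Strict Implicit.
Unset Printing Implicit Defensive.

Import GRing.Theory.
Local Open Scope ring_scope.

(* The sequence (f 1, f 2, ...) as a finite sequence with its zero entries
   omitted; d must be such that f k = 0 for all k > d. *)
Definition finseq (d : nat) (f : nat -> nat) : seq nat :=
  [seq x <- [seq f k | k <- iota 1 d] | x != 0%N].

Section LinearRelations.
Variables (K : fieldType) (X : vectType K).
Implicit Types (S : {vspace X * X}) (l : K).

Definition dom S : {vspace X} := (linfun fst @: S)%VS.
Definition ran S : {vspace X} := (linfun snd @: S)%VS.
Definition nul S : {vspace X} := (linfun (fun x : X => (x, 0 : X)) @^-1: S)%VS.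
Definition mul S : {vspace X} := (linfun (fun y : X => (0 : X, y)) @^-1: S)%VS.

Definition shiftrel S l : {vspace X * X} :=
  (linfun (fun p : X * X => (p.1, p.2 - l *: p.1)) @: S)%VS.

Definition idrel : {vspace X * X} := limg (linfun (fun x : X => (x, x))).

(* (x, z) is in [mulrel S1 S2] iff (x, y) is in S2 and (y, z) in S1 for some y;
   triples (x, (y, z)) are projected to (x, z). *)
Definition mulrel S1 S2 : {vspace X * X} :=
  (linfun (fun t : X * (X * X) => (t.1, t.2.2)) @:
     (linfun (fun t : X * (X * X) => (t.1, t.2.1)) @^-1: S2 :&:
      linfun (fun t : X * (X * X) => t.2) @^-1: S1))%VS.

Fixpoint exprel S (k : nat) : {vspace X * X} :=
  if k is j.+1 then mulrel S (exprel S j) else idrel.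

(* The unions over all k of N((S - l)^k) and of mul(S^k) are written as finite
   sums of subspaces; [mem_rootsp] and [mem_rootsp_inf] below identify them with
   the unions. *)
Definition rootsp S l : {vspace X} :=
  (\sum_(k < (\dim {:X}).+1) nul (exprel (shiftrel S l) k))%VS.
Definition rootsp_inf S : {vspace X} :=
  (\sum_(k < (\dim {:X}).+1) mul (exprel S k))%VS.
Definition rootsp_c S : {vspace X} := (rootsp S 0 :&: rootsp_inf S)%VS.

Definition releigenvalue S l : bool := nul (shiftrel S l) != 0%VS.
Definition proper_eigenvalue S l : bool :=
  releigenvalue S l && ~~ (rootsp S l <= rootsp_c S)%VS.

(* dim (U / U') for U' <= U, which holds in all uses below. *)
Definition qdim (U U' : {vspace X}) : nat := (\dim U - \dim U')%N.

(* The entries, for k >= 1; they vanish for k > dim X ([Wk_eq0] to [Ck_eq0]). *)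
Definition Wk S l (k : nat) : nat :=
  qdim (nul (exprel (shiftrel S l) k) + rootsp_c S)
       (nul (exprel (shiftrel S l) k.-1) + rootsp_c S).
Definition Ak S (k : nat) : nat :=
  qdim (mul (exprel S k) + rootsp_c S) (mul (exprel S k.-1) + rootsp_c S).
Definition Bk S (k : nat) : nat :=
  qdim (nul (exprel S k) :&: rootsp_c S) (nul (exprel S k.-1) :&: rootsp_c S).
Definition Ck S (k : nat) : nat :=
  if k == 1%N then qdim (ran S + dom S) (ran S + rootsp S 0)
  else qdim (ran (exprel S k) + rootsp S 0) (ran (exprel S k.+1) + rootsp S 0).

Definition weyrW S l : seq nat := finseq (\dim {:X}) (Wk S l).
Definition weyrA S : seq nat := finseq (\dim {:X}) (Ak S).
Definition weyrB S : seq nat := finseq (\dim {:X}) (Bk S).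
Definition weyrC S : seq nat := finseq (\dim {:X}) (Ck S).

(* |W|: the index set, the finite proper eigenvalues of S, is finite. *)
Definition sizeW S : nat :=
  \big[addn/0%N]_(l \in [set l : K | proper_eigenvalue S l]%classic)
    sumn (weyrW S l).

Lemma linfunE (aT rT : vectType K) (f : aT -> rT) : linear f -> linfun f =1 f.
Proof.
move=> lf; pose M := GRing.isLinear.Build K aT rT *:%R f lf.
pose g : {linear aT -> rT} := HB.pack f M.
exact: (lfunE g).
Qed.

Lemma mem_dom S x : reflect (exists y, (x, y) \in S) (x \in dom S).
Proof.
apply: (iffP memv_imgP) => [[[a b] Sab]|[y Sxy]].
  by rewrite lfunE /= => ->; exists b.
by exists (x, y) => //; rewrite lfunE.
Qed.

Lemma mem_ran S y : reflect (exists x, (x, y) \in S) (y \in ran S).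
Proof.
apply: (iffP memv_imgP) => [[[a b] Sab]|[x Sxy]].
  by rewrite lfunE /= => ->; exists a.
by exists (x, y) => //; rewrite lfunE.
Qed.

Lemma mem_nul S x : (x \in nul S) = ((x, 0) \in S).
Proof.
rewrite -memv_preim linfunE // => a u v.
by congr pair; rewrite /= scaler0 addr0.
Qed.

Lemma mem_mul S y : (y \in mul S) = ((0, y) \in S).
Proof.
rewrite -memv_preim linfunE // => a u v.
by congr pair; rewrite /= scaler0 addr0.
Qed.

Lemma mem_shiftrel S l x y :
  ((x, y) \in shiftrel S l) = ((x, y + l *: x) \in S).
Proof.
have lin : linear (fun p : X * X => (p.1, p.2 - l *: p.1)).
  move=> a u v; congr pair => /=.
  rewrite scalerDr opprD scalerBr !scalerA [l * a]mulrC.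
  by rewrite addrACA.
apply/memv_imgP/idP => [[[a b] Sab]|Sxy].
  by rewrite linfunE //= => -[-> ->]; rewrite subrK.
by exists (x, y + l *: x) => //; rewrite linfunE //= addrK.
Qed.

Lemma mem_idrel x y : ((x, y) \in idrel) = (x == y).
Proof.
have lin : linear (fun x : X => (x, x)) by [].
apply/memv_imgP/eqP => [[z _]|->].
  by rewrite linfunE // => -[-> ->].
by exists y; rewrite ?memvf // linfunE.
Qed.

Lemma mem_mulrel S1 S2 x z :
  reflect (exists y, (x, y) \in S2 /\ (y, z) \in S1) ((x, z) \in mulrel S1 S2).
Proof.
have lin1 : linear (fun t : X * (X * X) => (t.1, t.2.2)) by [].
have lin2 : linear (fun t : X * (X * X) => (t.1, t.2.1)) by [].
have lin3 : linear (fun t : X * (X * X) => t.2) by [].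
apply: (iffP memv_imgP) => [[[a [b c]]]|[y [S2xy S1yz]]].
  rewrite memv_cap -!memv_preim !linfunE //= => /andP[h1 h2] [-> ->].
  by exists b.
exists (x, (y, z)); last by rewrite linfunE.
by rewrite memv_cap -!memv_preim !linfunE //= S2xy.
Qed.

Lemma exprelSr S k : exprel S k.+1 = mulrel (exprel S k) S.
Proof.
elim: k => [|k IH].
  apply/vspaceP => -[x z] /=; apply/mem_mulrel/mem_mulrel => -[y []].
    by rewrite mem_idrel => /eqP-> h; exists z; rewrite mem_idrel eqxx.
  by move=> h; rewrite mem_idrel => /eqP<-; exists x; rewrite mem_idrel eqxx.
rewrite -[LHS]/(mulrel S (exprel S k.+1)) {1}IH.
apply/vspaceP => -[x z] /=; apply/mem_mulrel/mem_mulrel.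
  case=> y [/mem_mulrel[u [hxu huy]] hyz].
  by exists u; split=> //; apply/mem_mulrel; exists y.
case=> u [hxu /mem_mulrel[y [huy hyz]]].
by exists y; split=> //; apply/mem_mulrel; exists u.
Qed.

Local Definition image S (U : {vspace X}) : {vspace X} :=
  (linfun snd @: (S :&: linfun fst @^-1: U))%VS.
Local Definition preimage S (U : {vspace X}) : {vspace X} :=
  (linfun fst @: (S :&: linfun snd @^-1: U))%VS.

Local Lemma mem_image S (U : {vspace X}) y :
  reflect (exists x, x \in U /\ (x, y) \in S) (y \in image S U).
Proof.
apply: (iffP memv_imgP) => [[[a b]]|[x [Ux Sxy]]].
  by rewrite memv_cap -memv_preim !lfunE /= => /andP[? ?] ->; exists a.
by exists (x, y); rewrite ?lfunE // memv_cap -memv_preim lfunE Sxy.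
Qed.

Local Lemma mem_preimage S (U : {vspace X}) x :
  reflect (exists y, y \in U /\ (x, y) \in S) (x \in preimage S U).
Proof.
apply: (iffP memv_imgP) => [[[a b]]|[y [Uy Sxy]]].
  by rewrite memv_cap -memv_preim !lfunE /= => /andP[? ?] ->; exists b.
by exists (x, y); rewrite ?lfunE // memv_cap -memv_preim lfunE Sxy.
Qed.

Local Lemma ran_exprelS S k : ran (exprel S k.+1) = image S (ran (exprel S k)).
Proof.
apply/vspaceP => z; apply/mem_ran/mem_image.
  by case=> x /mem_mulrel[y [h1 h2]]; exists y; split=> //; apply/mem_ran; exists x.
by case=> y [/mem_ran[x h1] h2]; exists x; apply/mem_mulrel; exists y.
Qed.

Local Lemma mul_exprelS S k : mul (exprel S k.+1) = image S (mul (exprel S k)).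
Proof.
apply/vspaceP => z; rewrite mem_mul; apply/mem_mulrel/mem_image.
  by case=> y [h1 h2]; exists y; rewrite mem_mul.
by case=> y [h1 h2]; exists y; rewrite -mem_mul.
Qed.

Local Lemma nul_exprelS S k :
  nul (exprel S k.+1) = preimage S (nul (exprel S k)).
Proof.
apply/vspaceP => x; rewrite mem_nul exprelSr; apply/mem_mulrel/mem_preimage.
  by case=> y [h1 h2]; exists y; rewrite mem_nul.
by case=> y [h1 h2]; exists y; rewrite -mem_nul.
Qed.

Lemma nul_exprel_sub S k : (nul (exprel S k) <= nul (exprel S k.+1))%VS.
Proof.
apply/subvP => x; rewrite !mem_nul => h; apply/mem_mulrel.
by exists 0; split=> //; exact: mem0v.
Qed.

Lemma mul_exprel_sub S k : (mul (exprel S k) <= mul (exprel S k.+1))%VS.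
Proof.
apply/subvP => x; rewrite !mem_mul exprelSr => h; apply/mem_mulrel.
by exists 0; split=> //; exact: mem0v.
Qed.

Lemma ran_exprel_sub S k : (ran (exprel S k.+1) <= ran (exprel S k))%VS.
Proof.
apply/subvP => z; rewrite exprelSr => /mem_ran[x /mem_mulrel[y [_ h]]].
by apply/mem_ran; exists y.
Qed.

Local Lemma chain_stable (U : nat -> {vspace X}) (Phi : {vspace X} -> {vspace X})
    (US : forall k, U k.+1 = Phi (U k))
    (Umono : (forall k, U k <= U k.+1)%VS \/ (forall k, U k.+1 <= U k)%VS) k :
  (\dim {:X} <= k)%N -> U k = U (\dim {:X}).
Proof.
set d := \dim {:X}.
have dimU j : (\dim (U j) <= d)%N by apply/dimvS/subvf.
suff [j [jd Uj]] : exists j, (j <= d)%N /\ U j.+1 = U j.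
  have E i : U (j + i)%N = U j.
    by elim: i => [|i IH]; rewrite ?addn0 // addnS US IH -US.
  move=> dk; rewrite -(subnKC (leq_trans jd dk)) E.
  by rewrite -(subnKC jd) E.
have [/existsP[j /eqP Uj]|] :=
    boolP [exists j : 'I_d.+1, U (j : nat).+1 == U j].
  by exists j; split=> //; rewrite -ltnS ltn_ord.
rewrite negb_exists => /forallP H.
have neq j : (j <= d)%N -> U j.+1 != U j.
  by move=> jd; apply: (H (Ordinal (jd : j < d.+1)%N)).
exfalso; case: Umono => mono.
  suff h j : (j <= d.+1)%N -> (j <= \dim (U j))%N.
    by have := leq_trans (h d.+1 (leqnn _)) (dimU _); rewrite ltnn.
  elim: j => // j IH jd; apply: leq_ltn_trans (IH (ltnW jd)) _.
  rewrite ltn_neqAle dimvS ?mono // andbT.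
  apply: contra (neq j jd) => /eqP e.
  by rewrite eq_sym eqEdim mono e leqnn.
suff h j : (j <= d.+1)%N -> (\dim (U j) + j <= d)%N.
  by have := leq_trans (leq_addl _ _) (h d.+1 (leqnn _)); rewrite ltnn.
elim: j => [|j IH] jd; first by rewrite addn0.
apply: leq_trans (IH (ltnW jd)); rewrite addnS ltn_add2r.
rewrite ltn_neqAle dimvS ?mono // andbT.
apply: contra (neq j jd) => /eqP e.
by rewrite eqEdim mono e leqnn.
Qed.

Lemma nul_exprel_stable S k :
  (\dim {:X} <= k)%N -> nul (exprel S k) = nul (exprel S (\dim {:X})).
Proof.
apply: (chain_stable (U := fun k => nul (exprel S k)) (nul_exprelS S)).
by left; apply: nul_exprel_sub.
Qed.

Lemma mul_exprel_stable S k :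
  (\dim {:X} <= k)%N -> mul (exprel S k) = mul (exprel S (\dim {:X})).
Proof.
apply: (chain_stable (U := fun k => mul (exprel S k)) (mul_exprelS S)).
by left; apply: mul_exprel_sub.
Qed.

Lemma ran_exprel_stable S k :
  (\dim {:X} <= k)%N -> ran (exprel S k) = ran (exprel S (\dim {:X})).
Proof.
apply: (chain_stable (U := fun k => ran (exprel S k)) (ran_exprelS S)).
by right; apply: ran_exprel_sub.
Qed.

Local Lemma mem_chain_sum (U : nat -> {vspace X}) x :
    (forall k, U k <= U k.+1)%VS ->
    (forall k, (\dim {:X} <= k)%N -> U k = U (\dim {:X})) ->
  reflect (exists k, x \in U k) (x \in \sum_(k < (\dim {:X}).+1) U k)%VS.
Proof.
move=> mono stab.
have le j i : (U j <= U (i + j)%N)%VS.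
  by elim: i => // i IH; apply: subv_trans IH (mono _).
have top j : (U j <= U (\dim {:X}))%VS.
  have [jd|dj] := leqP j (\dim {:X}); first by rewrite -(subnK jd).
  by rewrite (stab j) // ltnW.
have -> : (\sum_(k < (\dim {:X}).+1) U k)%VS = U (\dim {:X}).
  apply: subv_anti; apply/andP; split; first by apply/subv_sumP => i _.
  exact: (sumv_sup ord_max).
by apply: (iffP idP) => [|[k]]; [exists (\dim {:X}) | apply/subvP].
Qed.

Lemma mem_rootsp S l x :
  reflect (exists k, x \in nul (exprel (shiftrel S l) k)) (x \in rootsp S l).
Proof.
by apply: mem_chain_sum; [apply: nul_exprel_sub | apply: nul_exprel_stable].
Qed.

Lemma mem_rootsp_inf S y :
  reflect (exists k, y \in mul (exprel S k)) (y \in rootsp_inf S).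
Proof.
by apply: mem_chain_sum; [apply: mul_exprel_sub | apply: mul_exprel_stable].
Qed.

Lemma Wk_eq0 S l k : (\dim {:X} < k)%N -> Wk S l k = 0%N.
Proof.
case: k => // k dk; rewrite /Wk /qdim /= -[mulrel _ _]/(exprel _ k.+1).
by rewrite !(@nul_exprel_stable _ k.+1, @nul_exprel_stable _ k) ?subnn // ltnW.
Qed.

Lemma Ak_eq0 S k : (\dim {:X} < k)%N -> Ak S k = 0%N.
Proof.
case: k => // k dk; rewrite /Ak /qdim /= -[mulrel _ _]/(exprel _ k.+1).
by rewrite !(@mul_exprel_stable _ k.+1, @mul_exprel_stable _ k) ?subnn // ltnW.
Qed.

Lemma Bk_eq0 S k : (\dim {:X} < k)%N -> Bk S k = 0%N.
Proof.
case: k => // k dk; rewrite /Bk /qdim /= -[mulrel _ _]/(exprel _ k.+1).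
by rewrite !(@nul_exprel_stable _ k.+1, @nul_exprel_stable _ k) ?subnn // ltnW.
Qed.

Lemma Ck_eq0 S k : (\dim {:X} < k)%N -> Ck S k = 0%N.
Proof.
move=> dk; rewrite /Ck; case: eqP => [k1|_].
  move: dk; rewrite k1 ltnS leqn0 => /eqP d0.
  rewrite /qdim; apply/eqP; rewrite subn_eq0.
  by apply: leq_trans (dimvS (subvf _)) _; rewrite d0.
rewrite /qdim (ran_exprel_stable _ (ltnW dk)).
by rewrite (@ran_exprel_stable _ k.+1) ?subnn // ltnW // ltnW.
Qed.

End LinearRelations.

Section Pencils.
Variable K : fieldType.

Definition diag2 (R : pzRingType) m1 n1 m2 n2
    (M1 : 'M[R]_(m1, n1)) (M2 : 'M[R]_(m2, n2)) : 'M[R]_(m1 + m2, n1 + n2) :=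
  block_mx M1 0 0 M2.

Fixpoint bdiag (T : Type) (r c : T -> nat) (B : forall t, 'M[K]_(r t, c t))
    (s : seq T) : 'M[K]_(sumn (map r s), sumn (map c s)) :=
  if s is t :: s' then diag2 (B t) (bdiag B s') else 0.

Definition Nblock k : 'M[K]_k := \matrix_(i, j) (i == j.+1 :> nat)%:R.
Definition Kblock k : 'M[K]_(k.-1, k) := \matrix_(i, j) (i == j :> nat)%:R.
Definition Lblock k : 'M[K]_(k.-1, k) := \matrix_(i, j) (i.+1 == j :> nat)%:R.
Definition Jblock (t : K * nat) : 'M[K]_t.2 := t.1%:M + Nblock t.2.

(* The Jordan matrix with blocks of eigenvalue t.1 and size t.2, t in J. *)
Definition jordan (J : seq (K * nat)) : 'M[K]_(sumn (map snd J)) := bdiag Jblock J.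
Definition Nmx (a : seq nat) := bdiag (r := id) (c := id) Nblock a.
Definition Kmx (a : seq nat) := bdiag (r := predn) (c := id) Kblock a.
Definition Lmx (a : seq nat) := bdiag (r := predn) (c := id) Lblock a.

(* sE - F *)
Definition pencil n m (E F : 'M[K]_(n, m)) : 'M[{poly K}]_(n, m) :=
  'X *: map_mx polyC E - map_mx polyC F.

Definition kronecker (J : seq (K * nat)) (a b c : seq nat) :=
  diag2 (pencil 1%:M (jordan J))
    (diag2 (pencil (Nmx a) 1%:M)
      (diag2 (pencil (Kmx b) (Lmx b)) (pencil (Kmx c)^T (Lmx c)^T))).

Definition multiindex (a : seq nat) : Prop := sorted geq a /\ 0%N \notin a.

Definition kronecker_form n m (E F : 'M[K]_(n, m))
    (J : seq (K * nat)) (a b c : seq nat) : Prop :=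
  [/\ 0%N \notin map snd J, multiindex a, multiindex b, multiindex c &
   exists (V : 'M[K]_n) (U : 'M[K]_m) (en : n = _) (em : m = _),
     [/\ V \in unitmx, U \in unitmx &
      castmx (en, em) (map_mx polyC V *m pencil E F *m map_mx polyC U) =
      kronecker J a b c]].

Definition nulmx n m (M : 'M[K]_(n, m)) : {vspace 'cV[K]_m} :=
  lker (linfun (mulmx M : 'cV_m -> 'cV_n)).

Definition wk n (M : 'M[K]_n) (l : K) (k : nat) : nat :=
  qdim (nulmx ((M - l%:M) ^+ k)) (nulmx ((M - l%:M) ^+ k.-1)).
Definition weyrmx n (M : 'M[K]_n) (l : K) : seq nat := finseq n (wk M l).

Lemma mem_nulmx n m (M : 'M[K]_(n, m)) x : (x \in nulmx M) = (M *m x == 0).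
Proof. by rewrite memv_ker lfunE. Qed.

Lemma wk_eq0 n (M : 'M[K]_n) l k : (n < k)%N -> wk M l k = 0%N.
Proof.
case: k => // k nk; rewrite /wk /=; set A := M - l%:M.
have dimn : \dim {:'cV[K]_n} = n by rewrite dimvf /dim /= muln1.
have US j : nulmx (A ^+ j.+1) =
    (linfun (mulmx A : 'cV_n -> 'cV_n) @^-1: nulmx (A ^+ j))%VS.
  apply/vspaceP => x; rewrite -memv_preim lfunE !mem_nulmx exprSr.
  by rewrite -mulmxA.
have mono j : (nulmx (A ^+ j) <= nulmx (A ^+ j.+1))%VS.
  apply/subvP => x; rewrite !mem_nulmx exprS => /eqP h.
  by rewrite -mulmxA h mulmx0.
have st := chain_stable (U := fun k => nulmx (A ^+ k)) US (or_introl mono).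
by rewrite /qdim st ?dimn 1?ltnW // [X in (_ - \dim X)%N]st ?dimn // subnn.
Qed.

Definition conjpart (a : seq nat) : seq nat :=
  finseq (\max_(x <- a) x) (fun k => count (leq k) a).

(* E^{-1} F *)
Definition kerrep n m (E F : 'M[K]_(n, m)) : {vspace 'cV[K]_m * 'cV[K]_m} :=
  lker (linfun (fun p : 'cV[K]_m * 'cV[K]_m => F *m p.1 - E *m p.2)).

Lemma mem_kerrep n m (E F : 'M[K]_(n, m)) x y :
  ((x, y) \in kerrep E F) = (F *m x == E *m y).
Proof.
rewrite memv_ker linfunE ?subr_eq0 // => a u v /=.
rewrite !mulmxDr -!scalemxAr scalerBr opprD.
by rewrite addrACA.
Qed.

End Pencils.

Definition omit_trailing0 (s : seq int) : seq int :=
  rev (drop (find (predC1 0) (rev s)) (rev s)).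

(* Main.v *)
From mathcomp Require Import all_boot all_order all_algebra zify.
From mathcomp Require Import classical_sets fsbigop.
From mathcomp Require Import reals complex.
Require Import Defs.

(** Passing from S to its image under an invertible U changes none of the
dimensions in the Weyr characteristic, and neither does multiplying E and F on
the left by an invertible V. So S may be replaced by the kernel representation
of the Kronecker canonical form, and that relation is the direct sum of the
kernel representations of the blocks. Powers, shifts, kernels, ranges,
multivalued parts, root spaces and the space [rootsp_c] all commute with direct
sums, hence every entry of the Weyr characteristic is additive
([has_weyr_split]; the isomorphism invariance [has_weyr_iso] is the case of a
zero-dimensional second summand).

It remains to look at one block at a time, where every relation is, up to adding
a scalar, a shift of coordinates:
- a Jordan block J gives the graph of J, which has only finite root vectors, and
  [Wk] reduces to the kernels of the powers of J - l ([has_weyr_Jblock]);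
- the pencil s N - 1 of size k gives the inverse of the graph of N, whose powers
  have multivalued parts of dimensions 1, 2, ..., k ([has_weyr_Nblock]);
- the pencil s K - L gives (x, y) with x_{i+1} = y_i, a relation in which every
  vector lies both in the root space at 0 and in the one at infinity, so that
  [rootsp_c] is everything and only [Bk] can be nonzero ([has_weyr_KLblock]);
- the transposed pencil of parameter k gives in dimension k - 1 the shift
  defined on the vectors with last coordinate zero; it has no root vectors at
  all, and the ranges of its powers lose one dimension at a time
  ([has_weyr_KLblockT]). This yields a nonzero [Ck] exactly for the indices up
  to k - 2, which is why the entries of C are the entries of c from the third
  on.

Summing over the blocks, W, A, B and C count the blocks of each type of at least
a given size ([kronecker_form_has_weyr]); this is the claim for w, a and b. The
first two entries of c do not occur in C, since a transposed block of parameter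
1 is a zero row and one of parameter 2 is the zero relation on a line, and are
recovered from the number of rows and of columns of the canonical form:
n - m is the number of transposed blocks minus the number of blocks s K - L, and
m is the sum of the dimensions of all blocks. *)

Set Implicit Arguments.
Unset Strict Implicit.
Unset Printing Implicit Defensive.
Import GRing.Theory.
Local Open Scope ring_scope.

(** * Powers of a linear relation *)

Section RelationPowers.
Variables (K : fieldType) (X : vectType K).
Implicit Type S : {vspace X * X}.

Lemma nul_exprel_mono S i j : (i <= j)%N ->
  (nul (exprel S i) <= nul (exprel S j))%VS.
Proof.
by apply: (@homo_leq _ (fun k => nul (exprel S k)) (fun U V => U <= V)%VS);
  [exact: subvv|move=> ? ? ?; exact: subv_trans|exact: nul_exprel_sub].
Qed.

Lemma mul_exprel_mono S i j : (i <= j)%N ->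
  (mul (exprel S i) <= mul (exprel S j))%VS.
Proof.
by apply: (@homo_leq _ (fun k => mul (exprel S k)) (fun U V => U <= V)%VS);
  [exact: subvv|move=> ? ? ?; exact: subv_trans|exact: mul_exprel_sub].
Qed.

Lemma nul_exprel_eq0 S : nul S = 0%VS -> forall k, nul (exprel S k) = 0%VS.
Proof.
move=> S0; elim=> [|k IH]; apply/vspaceP => x; rewrite memv0 mem_nul.
  by rewrite mem_idrel.
rewrite exprelSr; apply/mem_mulrel/eqP => [[y [h1]]|->].
  rewrite -mem_nul IH memv0 => /eqP y0.
  by move: h1; rewrite y0 -mem_nul S0 memv0 => /eqP.
by exists 0; rewrite !mem0v.
Qed.

Lemma mul_exprel_eq0 S : mul S = 0%VS -> forall k, mul (exprel S k) = 0%VS.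
Proof.
move=> S0; elim=> [|k IH]; apply/vspaceP => x; rewrite memv0 mem_mul.
  by rewrite mem_idrel eq_sym.
apply/mem_mulrel/eqP => [[y [h1]]|->].
  move: h1; rewrite -mem_mul IH memv0 => /eqP-> .
  by rewrite -mem_mul S0 memv0 => /eqP.
by exists 0; rewrite !mem0v.
Qed.

Lemma ran_exprel_full S : ran S = fullv -> forall k, ran (exprel S k) = fullv.
Proof.
move=> S1; elim=> [|k IH]; apply/vspaceP => x; rewrite memvf; apply/mem_ran.
  by exists x; rewrite mem_idrel.
have /mem_ran[y Sy] : x \in ran S by rewrite S1 memvf.
have /mem_ran[z Sz] : y \in ran (exprel S k) by rewrite IH memvf.
by exists z; apply/mem_mulrel; exists y.
Qed.

Lemma rootsp_eq0 S l : nul (shiftrel S l) = 0%VS -> rootsp S l = 0%VS.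
Proof.
by move/nul_exprel_eq0=> h; rewrite /rootsp big1 // => k _; rewrite h.
Qed.

Lemma rootsp_inf_eq0 S : mul S = 0%VS -> rootsp_inf S = 0%VS.
Proof.
by move/mul_exprel_eq0=> h; rewrite /rootsp_inf big1 // => k _; rewrite h.
Qed.

Lemma shiftrel0 S : shiftrel S 0 = S.
Proof. by apply/vspaceP => -[x y]; rewrite mem_shiftrel scale0r addr0. Qed.

(** This makes the quotient in the definition of [Ck] at 1 a quotient by a
subspace, so that its dimension is additive. *)
Lemma rootsp_dom S : (rootsp S 0 <= dom S)%VS.
Proof.
apply/subvP => x /mem_rootsp[[|k]]; rewrite shiftrel0 mem_nul.
  by rewrite mem_idrel => /eqP->; rewrite mem0v.
by rewrite exprelSr => /mem_mulrel[y [h _]]; apply/mem_dom; exists y.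
Qed.

Lemma mem_nul_exprelS S k x :
  x \in nul (exprel S k.+1) <->
  exists y, (x, y) \in S /\ y \in nul (exprel S k).
Proof.
rewrite mem_nul exprelSr; split=> [/mem_mulrel[y]|[y]].
  by rewrite -mem_nul; exists y.
by rewrite mem_nul => h; apply/mem_mulrel; exists y.
Qed.

Lemma mem_mul_exprelS S k y :
  y \in mul (exprel S k.+1) <->
  exists x, (x, y) \in S /\ x \in mul (exprel S k).
Proof.
rewrite mem_mul; split=> [/mem_mulrel[x [h1 h2]]|[x]].
  by rewrite -mem_mul in h1; exists x.
by rewrite mem_mul => -[h1 h2]; apply/mem_mulrel; exists x.
Qed.

Lemma mem_ran_exprelS S k y :
  y \in ran (exprel S k.+1) <->
  exists x, (x, y) \in S /\ x \in ran (exprel S k).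
Proof.
split=> [/mem_ran[z /mem_mulrel[x [h1 h2]]]|[x [h1 /mem_ran[z h2]]]].
  by exists x; split=> //; apply/mem_ran; exists z.
by apply/mem_ran; exists z; apply/mem_mulrel; exists x.
Qed.

Lemma nul_exprel0 S : nul (exprel S 0) = 0%VS.
Proof. by apply/vspaceP => x; rewrite mem_nul mem_idrel memv0. Qed.

Lemma mul_exprel0 S : mul (exprel S 0) = 0%VS.
Proof. by apply/vspaceP => x; rewrite mem_mul mem_idrel memv0 eq_sym. Qed.

Lemma ran_exprel0 S : ran (exprel S 0) = fullv.
Proof.
by apply/vspaceP=> x; rewrite memvf; apply/mem_ran; exists x; rewrite mem_idrel.
Qed.

Lemma exprel1 S : exprel S 1 = S.
Proof.
apply/vspaceP => -[x y]; apply/mem_mulrel/idP => [[z []]|h].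
  by rewrite mem_idrel => /eqP->.
by exists x; rewrite mem_idrel.
Qed.

Lemma qdimvv (U : {vspace X}) : qdim U U = 0%N.
Proof. exact: subnn. Qed.

Lemma qdimvf (U : {vspace X}) : qdim U fullv = 0%N.
Proof. by apply/eqP; rewrite subn_eq0 dimvS ?subvf. Qed.

Lemma add_fullv (U : {vspace X}) : (fullv + U)%VS = fullv.
Proof. by apply: subv_anti; rewrite subvf addvSl. Qed.

Lemma addv_full (U : {vspace X}) : (U + fullv)%VS = fullv.
Proof. by rewrite addvC add_fullv. Qed.

End RelationPowers.

(** * Direct sums of linear relations *)

Section DirectSum.
Variables (K : fieldType) (X X1 X2 : vectType K).
Variables (f : 'Hom(X1, X)) (g : 'Hom(X2, X)).
Hypothesis fg_onto : forall x, exists x1 x2, x = f x1 + g x2.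
Hypothesis fg_inj : forall x1 x2, f x1 + g x2 = 0 -> x1 = 0 /\ x2 = 0.
Implicit Types (U : {vspace X1}) (V : {vspace X2}).

(** Where [f] and [g] satisfy [fg_onto] and [fg_inj], they exhibit [X] as the
direct sum of [X1] and [X2]. Working with the two injections rather than with
the product type covers block matrices and changes of coordinates alike. *)
Definition splitv U V : {vspace X} := (f @: U + g @: V)%VS.

Lemma mem_splitv U V x1 x2 :
  (f x1 + g x2 \in splitv U V) = (x1 \in U) && (x2 \in V).
Proof.
apply/idP/andP => [|[h1 h2]]; last by rewrite memv_add ?memv_img.
case/memv_addP=> _ /memv_imgP[y1 h1 ->] [_ /memv_imgP[y2 h2 ->]] /eqP.
rewrite -subr_eq0 opprD addrACA -!linearB /= => /eqP /fg_inj[/subr0_eq-> /subr0_eq->].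
by [].
Qed.

(** Determining a subspace on the vectors [f x1 + g x2] identifies it, so each
construction on relations is reduced to its membership rule. *)
Lemma splitvP (Z : {vspace X}) U V :
    (forall x1 x2, (f x1 + g x2 \in Z) = (x1 \in U) && (x2 \in V)) ->
  Z = splitv U V.
Proof.
move=> h; apply/vspaceP => x; have [x1 [x2 ->]] := fg_onto x.
by rewrite h mem_splitv.
Qed.

Lemma dim_splitv U V : \dim (splitv U V) = (\dim U + \dim V)%N.
Proof.
have kerf : lker f = 0%VS.
  apply/eqP; rewrite -subv0; apply/subvP => x; rewrite memv_ker => /eqP h.
  by have [|->] := @fg_inj x 0; rewrite ?h ?linear0 ?addr0 ?mem0v.
have kerg : lker g = 0%VS.
  apply/eqP; rewrite -subv0; apply/subvP => x; rewrite memv_ker => /eqP h.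
  by have [|_ ->] := @fg_inj 0 x; rewrite ?h ?linear0 ?addr0 ?mem0v.
rewrite dimv_disjoint_sum; first by rewrite !limg_dim_eq ?kerf ?kerg ?capv0.
apply/eqP; rewrite -subv0; apply/subvP => x; rewrite memv_cap.
case/andP=> /memv_imgP[y1 h1 ->] /memv_imgP[y2 h2] /eqP.
rewrite -subr_eq0 -linearN => /eqP /fg_inj[-> _].
by rewrite linear0 mem0v.
Qed.

Lemma splitvD U V U' V' :
  (splitv U V + splitv U' V')%VS = splitv (U + U') (V + V').
Proof. by rewrite /splitv !limgD Monoid.mulmACA. Qed.

Lemma splitvI U V U' V' :
  (splitv U V :&: splitv U' V')%VS = splitv (U :&: U') (V :&: V').
Proof.
by apply: splitvP => x1 x2; rewrite !memv_cap !mem_splitv andbACA.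
Qed.

Lemma qdim_splitv U V U' V' : (U' <= U)%VS -> (V' <= V)%VS ->
  qdim (splitv U V) (splitv U' V') = (qdim U U' + qdim V V')%N.
Proof.
move=> /dimvS s1 /dimvS s2; rewrite /qdim !dim_splitv.
by rewrite addnBA // addnBAC // subnDA.
Qed.

Definition splitrel (S : {vspace X * X}) (S1 : {vspace X1 * X1})
    (S2 : {vspace X2 * X2}) :=
  forall x1 x2 y1 y2, ((f x1 + g x2, f y1 + g y2) \in S) =
    ((x1, y1) \in S1) && ((x2, y2) \in S2).

Let zero_fg : 0 = f 0 + g 0. Proof. by rewrite !linear0 addr0. Qed.

Lemma nul_split S S1 S2 : splitrel S S1 S2 ->
  nul S = splitv (nul S1) (nul S2).
Proof.
by move=> h; apply: splitvP => x1 x2; rewrite !mem_nul {1}zero_fg h.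
Qed.

Lemma mul_split S S1 S2 : splitrel S S1 S2 ->
  mul S = splitv (mul S1) (mul S2).
Proof.
by move=> h; apply: splitvP => x1 x2; rewrite !mem_mul {1}zero_fg h.
Qed.

Lemma ran_split S S1 S2 : splitrel S S1 S2 ->
  ran S = splitv (ran S1) (ran S2).
Proof.
move=> h; apply: splitvP => y1 y2; apply/mem_ran/andP => [[x]|].
  have [x1 [x2 ->]] := fg_onto x; rewrite h => /andP[h1 h2].
  by split; apply/mem_ran; [exists x1 | exists x2].
case=> /mem_ran[x1 h1] /mem_ran[x2 h2].
by exists (f x1 + g x2); rewrite h h1.
Qed.

Lemma dom_split S S1 S2 : splitrel S S1 S2 ->
  dom S = splitv (dom S1) (dom S2).
Proof.
move=> h; apply: splitvP => y1 y2; apply/mem_dom/andP => [[x]|].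
  have [x1 [x2 ->]] := fg_onto x; rewrite h => /andP[h1 h2].
  by split; apply/mem_dom; [exists x1 | exists x2].
case=> /mem_dom[x1 h1] /mem_dom[x2 h2].
by exists (f x1 + g x2); rewrite h h1.
Qed.

Lemma shiftrel_split S S1 S2 l : splitrel S S1 S2 ->
  splitrel (shiftrel S l) (shiftrel S1 l) (shiftrel S2 l).
Proof.
move=> h x1 x2 y1 y2; rewrite !mem_shiftrel -h scalerDr addrACA.
by rewrite !linearD !linearZ.
Qed.

Lemma exprel_split S S1 S2 k : splitrel S S1 S2 ->
  splitrel (exprel S k) (exprel S1 k) (exprel S2 k).
Proof.
move=> h; elim: k => [|k IH] x1 x2 y1 y2 /=.
  rewrite !mem_idrel -subr_eq0 opprD addrACA -!linearB.
  apply/eqP/andP => [/fg_inj[/subr0_eq-> /subr0_eq->] //|[/eqP-> /eqP->]].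
  by rewrite !subrr !linear0 addr0.
apply/mem_mulrel/andP => [[y]|].
  have [z1 [z2 ->]] := fg_onto y; rewrite IH h => -[/andP[a1 a2] /andP[b1 b2]].
  by split; apply/mem_mulrel; [exists z1 | exists z2].
case=> /mem_mulrel[z1 [a1 b1]] /mem_mulrel[z2 [a2 b2]].
by exists (f z1 + g z2); rewrite IH h a1 a2 b1 b2.
Qed.
End DirectSum.

Section WeyrSplit.
Variables (K : fieldType) (X X1 X2 : vectType K).
Variables (f : 'Hom(X1, X)) (g : 'Hom(X2, X)).
Hypothesis fg_onto : forall x, exists x1 x2, x = f x1 + g x2.
Hypothesis fg_inj : forall x1 x2, f x1 + g x2 = 0 -> x1 = 0 /\ x2 = 0.
Variables (S : {vspace X * X}) (S1 : {vspace X1 * X1}) (S2 : {vspace X2 * X2}).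
Hypothesis hS : splitrel f g S S1 S2.
Let sp := splitv f g.

Let nulSk l k : nul (exprel (shiftrel S l) k) =
  sp (nul (exprel (shiftrel S1 l) k)) (nul (exprel (shiftrel S2 l) k)).
Proof. by apply: nul_split => //; apply/exprel_split/shiftrel_split. Qed.

Let mulSk k : mul (exprel S k) = sp (mul (exprel S1 k)) (mul (exprel S2 k)).
Proof. by apply: mul_split => //; apply/exprel_split. Qed.

Let ranSk k : ran (exprel S k) = sp (ran (exprel S1 k)) (ran (exprel S2 k)).
Proof. by apply: ran_split => //; apply/exprel_split. Qed.

Let rootS l : rootsp S l = sp (rootsp S1 l) (rootsp S2 l).
Proof.
apply: splitvP => // x1 x2; apply/mem_rootsp/andP => [[k]|].
  rewrite nulSk mem_splitv // => /andP[h1 h2].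
  by split; apply/mem_rootsp; exists k.
case=> /mem_rootsp[k1 h1] /mem_rootsp[k2 h2]; exists (k1 + k2)%N.
rewrite nulSk mem_splitv //.
rewrite (subvP (nul_exprel_mono _ (leq_addr k2 k1)) _ h1).
by rewrite (subvP (nul_exprel_mono _ (leq_addl k1 k2)) _ h2).
Qed.

Let rootinfS : rootsp_inf S = sp (rootsp_inf S1) (rootsp_inf S2).
Proof.
apply: splitvP => // x1 x2; apply/mem_rootsp_inf/andP => [[k]|].
  rewrite mulSk mem_splitv // => /andP[h1 h2].
  by split; apply/mem_rootsp_inf; exists k.
case=> /mem_rootsp_inf[k1 h1] /mem_rootsp_inf[k2 h2]; exists (k1 + k2)%N.
rewrite mulSk mem_splitv //.
rewrite (subvP (mul_exprel_mono _ (leq_addr k2 k1)) _ h1).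
by rewrite (subvP (mul_exprel_mono _ (leq_addl k1 k2)) _ h2).
Qed.

Let rootcS : rootsp_c S = sp (rootsp_c S1) (rootsp_c S2).
Proof. by rewrite /rootsp_c rootS rootinfS /sp splitvI. Qed.

Lemma Wk_split l k : Wk S l k = (Wk S1 l k + Wk S2 l k)%N.
Proof.
rewrite /Wk !nulSk rootcS /sp !splitvD qdim_splitv //;
  by rewrite addvS ?subvv // nul_exprel_mono ?leq_pred.
Qed.

Lemma Ak_split k : Ak S k = (Ak S1 k + Ak S2 k)%N.
Proof.
rewrite /Ak !mulSk rootcS /sp !splitvD qdim_splitv //;
  by rewrite addvS ?subvv // mul_exprel_mono ?leq_pred.
Qed.

Lemma Bk_split k : Bk S k = (Bk S1 k + Bk S2 k)%N.
Proof.
have nk j := nulSk 0 j; rewrite !shiftrel0 in nk.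
rewrite /Bk !nk rootcS /sp !splitvI // qdim_splitv //;
  by rewrite capvS ?subvv // nul_exprel_mono ?leq_pred.
Qed.

Lemma Ck_split k : Ck S k = (Ck S1 k + Ck S2 k)%N.
Proof.
rewrite /Ck; case: ifP => _; last first.
  rewrite !ranSk rootS /sp !splitvD qdim_splitv //;
  by rewrite addvS ?subvv // ran_exprel_sub.
rewrite (ran_split fg_onto fg_inj hS) (dom_split fg_onto fg_inj hS) rootS.
by rewrite /sp !splitvD qdim_splitv // addvS ?subvv // rootsp_dom.
Qed.
End WeyrSplit.

(** * Weyr data of relations that split into blocks *)

Section WeyrData.
Variable K : fieldType.

(** The Weyr data of [S] are those of a pencil with Jordan blocks [J] and
Kronecker parameters [a], [b], [c]. The index is [k.+1] because the sequences
start at 1; [Ck] at index [k.+1] is the entry [k.+3] of the conjugate partition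
of [c]. *)
Definition has_weyr (X : vectType K) (S : {vspace X * X})
    (J : seq (K * nat)) (a b c : seq nat) :=
  forall k, [/\ forall l,
      Wk S l k.+1 = count (fun t => (t.1 == l) && (k < t.2))%N J,
    Ak S k.+1 = count (leq k.+1) a, Bk S k.+1 = count (leq k.+1) b &
    Ck S k.+1 = count (leq k.+3) c].

Lemma has_weyr_split (X X1 X2 : vectType K) (f : 'Hom(X1, X)) (g : 'Hom(X2, X))
    S S1 S2 J1 J2 a1 a2 b1 b2 c1 c2 :
  (forall x, exists x1 x2, x = f x1 + g x2) ->
  (forall x1 x2, f x1 + g x2 = 0 -> x1 = 0 /\ x2 = 0) ->
  splitrel f g S S1 S2 ->
  has_weyr S1 J1 a1 b1 c1 -> has_weyr S2 J2 a2 b2 c2 ->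
  has_weyr S (J1 ++ J2) (a1 ++ a2) (b1 ++ b2) (c1 ++ c2).
Proof.
move=> onto inj hS h1 h2 k.
have [W1 A1 B1 C1] := h1 k; have [W2 A2 B2 C2] := h2 k.
split=> [l|||]; rewrite count_cat.
- by rewrite (Wk_split onto inj hS) W1 W2.
- by rewrite (Ak_split onto inj hS) A1 A2.
- by rewrite (Bk_split onto inj hS) B1 B2.
by rewrite (Ck_split onto inj hS) C1 C2.
Qed.

Lemma has_weyr_dim0 (X : vectType K) (S : {vspace X * X}) :
  \dim {:X} = 0%N -> has_weyr S [::] [::] [::] [::].
Proof.
move=> d0 k; have q0 (U V : {vspace X}) : qdim U V = 0%N.
  by apply/eqP; rewrite subn_eq0 (leq_trans (dimvS (subvf U))) ?d0.
by split=> [l|||]; rewrite ?/Wk ?/Ak ?/Bk ?/Ck ?q0 //; case: ifP.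
Qed.

(** An isomorphism is a direct sum decomposition whose second summand is zero. *)
Lemma has_weyr_iso (X Y : vectType K) (f : 'Hom(Y, X))
    (S : {vspace X * X}) (T : {vspace Y * Y}) J a b c :
  (forall x, exists y, x = f y) -> (forall y, f y = 0 -> y = 0) ->
  (forall x y, ((f x, f y) \in S) = ((x, y) \in T)) ->
  has_weyr T J a b c -> has_weyr S J a b c.
Proof.
move=> onto inj hS h.
have h0 := @has_weyr_dim0 _ (idrel 'cV[K]_0).
rewrite dimvf /dim /= in h0; have {h0} := h0 erefl.
move=> /(@has_weyr_split X Y 'cV[K]_0 f 0 S T _ J [::] a [::] b [::] c [::]).
rewrite !cats0; apply=> //.
- by move=> x; have [y ->] := onto x; exists y, 0; rewrite linear0 addr0.
- move=> x1 x2; rewrite zero_lfunE addr0 => /inj->; split=> //.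
  by apply/matrixP=> -[].
move=> x1 x2 y1 y2; rewrite !zero_lfunE !addr0 hS mem_idrel.
rewrite (_ : x2 = y2) ?eqxx ?andbT //.
by apply/matrixP=> -[].
Qed.

Lemma has_weyr_diag2 n1 m1 n2 m2 (E1 F1 : 'M[K]_(n1, m1))
    (E2 F2 : 'M[K]_(n2, m2)) J1 J2 a1 a2 b1 b2 c1 c2 :
  has_weyr (kerrep E1 F1) J1 a1 b1 c1 -> has_weyr (kerrep E2 F2) J2 a2 b2 c2 ->
  has_weyr (kerrep (diag2 E1 E2) (diag2 F1 F2))
    (J1 ++ J2) (a1 ++ a2) (b1 ++ b2) (c1 ++ c2).
Proof.
pose f : 'cV[K]_m1 -> 'cV[K]_(m1 + m2) := fun x => col_mx x 0.
pose g : 'cV[K]_m2 -> 'cV[K]_(m1 + m2) := fun x => col_mx 0 x.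
have lf : linear f.
  by move=> a u v; rewrite /f scale_col_mx add_col_mx scaler0 addr0.
have lg : linear g.
  by move=> a u v; rewrite /g scale_col_mx add_col_mx scaler0 addr0.
have fg x1 x2 : linfun f x1 + linfun g x2 = col_mx x1 x2.
  by rewrite !linfunE // /f /g add_col_mx addr0 add0r.
apply: (@has_weyr_split _ _ _ (linfun f) (linfun g)).
- by move=> x; exists (usubmx x), (dsubmx x); rewrite fg vsubmxK.
- move=> x1 x2; rewrite fg -[RHS](vsubmxK 0) => /eq_col_mx[-> ->].
  by rewrite !linear0.
move=> x1 x2 y1 y2; rewrite !fg !mem_kerrep /diag2 !mul_block_col.
rewrite !mul0mx !addr0 !add0r.
by apply/eqP/andP => [/eq_col_mx[-> ->]|[/eqP-> /eqP->]].
Qed.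

Lemma has_weyr_equiv n m (E F E' F' : 'M[K]_(n, m)) (V : 'M[K]_n) (U : 'M[K]_m)
    J a b c :
  V \in unitmx -> U \in unitmx -> V *m E *m U = E' -> V *m F *m U = F' ->
  has_weyr (kerrep E' F') J a b c -> has_weyr (kerrep E F) J a b c.
Proof.
move=> uV uU <- <-; apply: (has_weyr_iso (f := linfun (mulmx U))).
- by move=> x; exists (invmx U *m x); rewrite lfunE /= mulKVmx.
- by move=> y; rewrite lfunE /= => h; rewrite -[y](mulKmx uU) h mulmx0.
move=> x y; rewrite !lfunE /= !mem_kerrep -!mulmxA.
by rewrite (can_eq (mulKmx uV)).
Qed.

End WeyrData.

(** * Coordinate subspaces and the entries of shifted vectors *)

Section Coordinates.
Variable K : fieldType.

(** Extending a vector by zero outside its range lets the products with the shift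
matrices be described without case distinctions at the boundary. *)
Definition entry m (x : 'cV[K]_m) (i : nat) : K :=
  oapp (fun j : 'I_m => x j 0) 0 (insub i).

Lemma entry_ord m (x : 'cV[K]_m) (i : 'I_m) : entry x i = x i 0.
Proof. by rewrite /entry valK. Qed.

Lemma entry_out m (x : 'cV[K]_m) i : (m <= i)%N -> entry x i = 0.
Proof. by move=> h; rewrite /entry insubF // ltnNge h. Qed.

Lemma entryP m (x y : 'cV[K]_m) :
  (forall i, (i < m)%N -> entry x i = entry y i) <-> x = y.
Proof.
split=> [h|-> //]; apply/matrixP => i j; rewrite (ord1 j).
by rewrite -!entry_ord h.
Qed.

Lemma entry0 m i : entry (0 : 'cV_m) i = 0.
Proof. by rewrite /entry; case: insub => //= j; rewrite mxE. Qed.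

Lemma entryD m (x y : 'cV[K]_m) i : entry (x + y) i = entry x i + entry y i.
Proof. by rewrite /entry; case: insub => [j|] /=; rewrite ?mxE ?addr0. Qed.

Lemma entryZ m (x : 'cV[K]_m) a i : entry (a *: x) i = a * entry x i.
Proof. by rewrite /entry; case: insub => [j|] /=; rewrite ?mxE ?mulr0. Qed.

Definition colfun m (h : nat -> K) : 'cV[K]_m := \col_i h i.

Lemma entry_colfun m (h : nat -> K) i :
  entry (colfun m h) i = if (i < m)%N then h i else 0.
Proof.
by rewrite /entry; case: insubP => [j -> <-|/negPf->] //=; rewrite mxE.
Qed.

(** A row of the matrix that is zero except for a 1 in column [j], or that is zero
when [j] is out of range, selects the entry [j]. *)
Lemma entry_mulmx p m (M : 'M[K]_(p, m)) (x : 'cV[K]_m) (i : 'I_p) j :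
    (forall k : 'I_m, M i k = (k == j :> nat)%:R) ->
  (M *m x) i 0 = entry x j.
Proof.
move=> Mi; rewrite mxE; case: (ltnP j m) => jm.
  rewrite (bigD1 (Ordinal jm)) //= Mi eqxx mul1r -entry_ord /= big1 ?addr0 //.
  move=> k; rewrite -val_eqE Mi => /= /negPf->; exact: mul0r.
rewrite entry_out // big1 // => k _; rewrite Mi.
by rewrite ltn_eqF ?mul0r // (leq_trans _ jm).
Qed.

Lemma entry_Kblock k x i :
  entry (Kblock K k *m x) i = if (i < k.-1)%N then entry x i else 0.
Proof.
case: ltnP => ik; last by rewrite entry_out.
rewrite (entry_ord _ (Ordinal ik)).
by apply: entry_mulmx => j; rewrite mxE eq_sym.
Qed.

Lemma entry_Lblock k x i : entry (Lblock K k *m x) i = entry x i.+1.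
Proof.
have [ik|ik] := ltnP i k.-1; last by rewrite !entry_out //; lia.
rewrite (entry_ord _ (Ordinal ik)).
by apply: entry_mulmx => j; rewrite mxE eq_sym.
Qed.

Lemma entry_KblockT k x i : entry ((Kblock K k)^T *m x) i = entry x i.
Proof.
have [ik|ik] := ltnP i k; last by rewrite !entry_out //; lia.
rewrite (entry_ord _ (Ordinal ik)).
by apply: entry_mulmx => j; rewrite !mxE.
Qed.

Lemma entry_LblockT k x i :
  entry ((Lblock K k)^T *m x) i = if i is i'.+1 then entry x i' else 0.
Proof.
have [ik|ik] := ltnP i k; last by case: i ik => [|i] ik; rewrite !entry_out //; lia.
rewrite (entry_ord _ (Ordinal ik)); case: i ik => [|i] ik.
  by rewrite mxE big1 // => j _; rewrite !mxE mul0r.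
by apply: entry_mulmx => j; rewrite !mxE eqSS.
Qed.

Lemma entry_Nblock k x i :
  entry (Nblock K k *m x) i =
  if (i < k)%N then if i is i'.+1 then entry x i' else 0 else 0.
Proof.
have [ik|ik] := ltnP i k; last by rewrite entry_out.
rewrite (entry_ord _ (Ordinal ik)); case: i ik => [|i] ik.
  by rewrite mxE big1 // => j _; rewrite !mxE mul0r.
by apply: entry_mulmx => j; rewrite !mxE /= eqSS eq_sym.
Qed.

(** The span of the unit vectors whose index satisfies [P], cut out by the
vanishing of the other coordinates. *)
Definition coordsp m (P : pred nat) : {vspace 'cV[K]_m} :=
  lker (linfun (fun x : 'cV[K]_m => \col_i (if P i then 0 else x i 0))).

Lemma mem_coordsp m (P : pred nat) (x : 'cV[K]_m) :
  x \in coordsp m P <-> forall i, (i < m)%N -> ~~ P i -> entry x i = 0.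
Proof.
rewrite memv_ker linfunE => [|a u v]; last first.
  by apply/colP => i; rewrite !mxE; case: ifP; rewrite ?mulr0 ?addr0.
split=> [/eqP/colP h i im /negPf Pi|h].
  by have := h (Ordinal im); rewrite !mxE /= Pi (entry_ord _ (Ordinal im)).
apply/eqP/colP => i; rewrite !mxE; case: ifPn => // Pi.
by rewrite -entry_ord h.
Qed.

(** Selecting the coordinates in [P] maps the subspace isomorphically onto the
column vectors whose length is the number of these coordinates. *)
Lemma dim_coordsp m (P : pred nat) : \dim (coordsp m P) = count P (iota 0 m).
Proof.
pose A := [set i : 'I_m | P i].
have -> : count P (iota 0 m) = #|A|.
  have -> : iota 0 m = index_iota 0 m by rewrite /index_iota subn0.
  by rewrite -sum1_count big_mkord sum1dep_card.
pose h := fun x : 'cV[K]_m => rowsub (enum_val : 'I_#|A| -> 'I_m) x.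
have linh : linear h by move=> a u v; rewrite /h !linearP.
rewrite -(@limg_dim_eq _ _ _ (linfun h)).
  transitivity (\dim {: 'cV[K]_#|A|}); last by rewrite dimvf /dim /= muln1.
  congr (\dim _); apply/vspaceP => y; rewrite memvf; apply/memv_imgP.
  exists (\col_i \sum_(j | enum_val j == i) y j 0).
    apply/mem_coordsp => i im Pi; rewrite (entry_ord _ (Ordinal im)) mxE.
    rewrite big_pred0 // => j; apply/eqP => ej.
    by have := enum_valP j; rewrite inE ej /= (negPf Pi).
  rewrite linfunE //; apply/colP => j; rewrite !mxE (big_pred1 j) // => k.
  by rewrite (inj_eq enum_val_inj).
apply/eqP; rewrite -subv0; apply/subvP => x; rewrite memv_cap memv_ker.
case/andP=> /mem_coordsp hx; rewrite linfunE // => /eqP/colP h0.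
rewrite memv0; apply/eqP/entryP => i im; rewrite entry0.
have [Pi|] := boolP (P i); last exact: hx.
have iA : Ordinal im \in A by rewrite inE.
have := h0 (enum_rank_in iA (Ordinal im)).
by rewrite !mxE enum_rankK_in // -entry_ord.
Qed.

Lemma coordsp_full m (P : pred nat) :
  (forall i, (i < m)%N -> P i) -> coordsp m P = fullv.
Proof.
move=> h; apply/vspaceP => x; rewrite memvf.
by apply/mem_coordsp => i /h->.
Qed.

Lemma coordsp0 m (P : pred nat) :
  (forall i, (i < m)%N -> ~~ P i) -> coordsp m P = 0%VS.
Proof.
move=> h; apply/vspaceP => x; rewrite memv0; apply/idP/eqP => [|->].
  by move/mem_coordsp => hx; apply/entryP => i im; rewrite entry0 hx ?h.
exact: mem0v.
Qed.

Lemma count_ltn j m : count (fun i => i < j)%N (iota 0 m) = minn j m.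
Proof.
elim: m => [|m IH]; first by rewrite minn0.
by rewrite -addn1 iotaD count_cat IH /=; lia.
Qed.

Lemma count_geq j m : count (leq j) (iota 0 m) = (m - j)%N.
Proof.
elim: m => [|m IH] //.
by rewrite -addn1 iotaD count_cat IH /=; lia.
Qed.

Lemma count_shift j m :
  count (fun i => m <= i + j)%N (iota 0 m) = minn j m.
Proof.
rewrite (@eq_count _ _ (leq (m - j)%N)) ?count_geq; first by lia.
by move=> i /=; lia.
Qed.

End Coordinates.

(** * The four types of Kronecker blocks *)

Section Blocks.
Variable K : fieldType.

(** The relation is x = N y. It has no eigenvectors for finite l, because
x = l N x forces the coordinates to vanish one after the other, so [rootsp_c] is
zero; it is onto, so there is no contribution to [Ck]. *)
Lemma has_weyr_Nblock k :
  has_weyr (kerrep (Nblock K k) 1%:M) [::] [:: k] [::] [::].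
Proof.
set S := kerrep _ _.
have memS x y : (x, y) \in S <->
  forall i, (i < k)%N -> entry x i = if i is i'.+1 then entry y i' else 0.
  rewrite mem_kerrep mul1mx; split=> [/eqP-> i ik|h].
    by rewrite entry_Nblock ik.
  by apply/eqP/entryP => i ik; rewrite entry_Nblock ik h.
have nul0 l : nul (shiftrel S l) = 0%VS.
  apply/vspaceP => x; rewrite memv0 mem_nul mem_shiftrel add0r.
  apply/idP/eqP => [/memS h|->]; last by rewrite scaler0 mem0v.
  apply/entryP => i; rewrite entry0.
  elim: i => [|i IH] ik; rewrite h // entryZ IH ?mulr0 //; exact: ltnW.
have rc0 : rootsp_c S = 0%VS by rewrite /rootsp_c rootsp_eq0 ?cap0v.
have mulS j : mul (exprel S j) = coordsp K k (fun i => k <= i + j)%N.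
  elim: j => [|j IH].
    by rewrite mul_exprel0 coordsp0 // => i ik; rewrite addn0 -ltnNge.
  apply/vspaceP => y; apply/idP/idP.
    case/mem_mul_exprelS=> x [/memS hx]; rewrite IH => /mem_coordsp h0.
    apply/mem_coordsp => i ik; rewrite -ltnNge => ij.
    rewrite -(hx i.+1) ?h0 //; lia.
  move/mem_coordsp => hy; apply/mem_mul_exprelS.
  exists (Nblock K k *m y); split; first by rewrite mem_kerrep mul1mx.
  rewrite IH; apply/mem_coordsp => i ik; rewrite -ltnNge entry_Nblock ik.
  by case: i ik => // i ik ij; apply: hy; lia.
have ranS : ran S = fullv.
  apply/vspaceP => y; rewrite memvf; apply/mem_ran.
  by exists (Nblock K k *m y); rewrite mem_kerrep mul1mx.
move=> j; split=> [l|||] /=.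
- by rewrite /Wk rc0 !addv0 !(nul_exprel_eq0 (nul0 l)) qdimvv.
- by rewrite /Ak rc0 !addv0 !mulS /qdim !dim_coordsp !count_shift; lia.
- by rewrite /Bk rc0 !capv0 qdimvv.
rewrite /Ck ranS !(ran_exprel_full ranS) !add_fullv; case: ifP => _; exact: qdimvv.
Qed.

(** The relation is x_{i+1} = y_i for i < k - 1, with x_0 and y_{k-1} free. A
vector killed by the j-th power has support in the first j coordinates, one in
the multivalued part of the j-th power has support in the last j. *)
Lemma has_weyr_KLblock k :
  has_weyr (kerrep (Kblock K k) (Lblock K k)) [::] [::] [:: k] [::].
Proof.
set S := kerrep _ _.
have memS x y : (x, y) \in S <->
  forall i, (i < k.-1)%N -> entry x i.+1 = entry y i.
  rewrite mem_kerrep; split=> [/eqP h i ik|h].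
    by rewrite -entry_Lblock h entry_Kblock ik.
  by apply/eqP/entryP => i ik; rewrite entry_Kblock entry_Lblock ik h.
have nulS j : nul (exprel S j) = coordsp K k (fun i => i < j)%N.
  elim: j => [|j IH]; first by rewrite nul_exprel0 coordsp0.
  apply/vspaceP => x; apply/idP/idP.
    case/mem_nul_exprelS=> y [/memS hx]; rewrite IH => /mem_coordsp h0.
    by apply/mem_coordsp => -[|i] // ik ij; rewrite hx ?h0 //; lia.
  move/mem_coordsp=> hx; apply/mem_nul_exprelS.
  exists (colfun k (fun i => entry x i.+1)); split.
    by apply/memS => i ik; rewrite entry_colfun ifT //; lia.
  rewrite IH; apply/mem_coordsp => i ik ij; rewrite entry_colfun ik.
  by have [?|?] := ltnP i.+1 k; [apply: hx | rewrite entry_out].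
have mulS j : mul (exprel S j) = coordsp K k (fun i => k <= i + j)%N.
  elim: j => [|j IH].
    by rewrite mul_exprel0 coordsp0 // => i ik; rewrite addn0 -ltnNge.
  apply/vspaceP => y; apply/idP/idP.
    case/mem_mul_exprelS=> x [/memS hx]; rewrite IH => /mem_coordsp h0.
    apply/mem_coordsp => i ik; rewrite -ltnNge => ij.
    rewrite -(hx i) ?h0 //; lia.
  move/mem_coordsp => hy; apply/mem_mul_exprelS.
  exists (colfun k (fun i => if i is i'.+1 then entry y i' else 0)); split.
    apply/memS=> i ik.
    rewrite entry_colfun ifT //.
    by lia.
  rewrite IH; apply/mem_coordsp => i ik; rewrite -ltnNge.
  rewrite entry_colfun ik.
  by case: i ik => // i ik ij; apply: hy; lia.
have r0 : rootsp S 0 = fullv.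
  apply/vspaceP => x; rewrite memvf; apply/mem_rootsp; exists k.
  by rewrite shiftrel0 nulS coordsp_full ?memvf.
have rinf : rootsp_inf S = fullv.
  apply/vspaceP => x; rewrite memvf; apply/mem_rootsp_inf; exists k.
  by rewrite mulS coordsp_full ?memvf // => i _; exact: leq_addl.
have rc : rootsp_c S = fullv by rewrite /rootsp_c r0 rinf capvv.
move=> j; split=> [l|||] /=.
- by rewrite /Wk rc !addv_full qdimvv.
- by rewrite /Ak rc !addv_full qdimvv.
- by rewrite /Bk rc !capvf !nulS /qdim !dim_coordsp !count_ltn; lia.
by rewrite /Ck r0 !addv_full !qdimvf; case: ifP.
Qed.

(** The relation is y_0 = 0, y_{i+1} = x_i in dimension k - 1, with the equation
x_{k-2} = 0 at the end. Here y = l x gives x_i = l x_{i+1}, so an eigenvector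
vanishes from the last coordinate downwards. The range of the j-th power consists
of the vectors whose first j coordinates vanish. *)
Lemma has_weyr_KLblockT k :
  has_weyr (kerrep (Kblock K k)^T (Lblock K k)^T) [::] [::] [::] [:: k].
Proof.
set S := kerrep _ _.
have memS x y : (x, y) \in S <->
  forall i, (i < k)%N -> entry y i = if i is i'.+1 then entry x i' else 0.
  rewrite mem_kerrep; split=> [/eqP h i ik|h].
    by rewrite -entry_KblockT -h entry_LblockT.
  by apply/eqP/entryP => i ik; rewrite entry_KblockT entry_LblockT h.
have nul0 l : nul (shiftrel S l) = 0%VS.
  apply/vspaceP => x; rewrite memv0 mem_nul mem_shiftrel add0r.
  apply/idP/eqP => [/memS h|->]; last by rewrite scaler0 mem0v.
  suff e j i : (k.-1 <= i + j)%N -> entry x i = 0.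
    by apply/entryP => i _; rewrite entry0 (e k.-1) // leq_addl.
  elim: j i => [|j IH] i hi; first by rewrite entry_out //; lia.
  have [ik|ik] := ltnP i k.-1; last by rewrite entry_out.
  rewrite -(h i.+1); last by lia.
  by rewrite entryZ IH ?mulr0 //; lia.
have mul0 : mul S = 0%VS.
  apply/vspaceP => y; rewrite memv0 mem_mul.
  apply/idP/eqP => [/memS h|->]; last exact: mem0v.
  apply/entryP => i ik; rewrite h; last by lia.
  by case: i ik => *; rewrite !entry0.
have r0 : rootsp S 0 = 0%VS by rewrite rootsp_eq0.
have rc0 : rootsp_c S = 0%VS by rewrite /rootsp_c r0 cap0v.
have ranS j : ran (exprel S j) = coordsp K k.-1 (leq j).
  elim: j => [|j IH]; first by rewrite ran_exprel0 coordsp_full.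
  apply/vspaceP => y; apply/idP/idP.
    case/mem_ran_exprelS=> x [/memS hx]; rewrite IH => /mem_coordsp h0.
    apply/mem_coordsp => i ik ij; rewrite hx; last by lia.
    by case: i ik ij => // i ik ij; apply: h0; lia.
  move/mem_coordsp=> hy; apply/mem_ran_exprelS.
  exists (colfun k.-1 (fun i => entry y i.+1)); split.
    apply/memS => -[|i] ik.
      by have [?|?] := ltnP 0%N k.-1; [apply: hy | rewrite entry_out].
    by rewrite entry_colfun ifT //; lia.
  rewrite IH; apply/mem_coordsp => i ik ij; rewrite entry_colfun ik.
  by have [?|?] := ltnP i.+1 k.-1; [apply: hy | rewrite entry_out].
have ran1 : ran S = coordsp K k.-1 (leq 1) by rewrite -ranS exprel1.
have domS x : x \in dom S <-> entry x k.-2 = 0.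
  split=> [/mem_dom[y /memS h]|h].
    have [k2|k2] := ltnP k 2; first by rewrite entry_out //; lia.
    by rewrite -(h k.-2.+1) ?entry_out //; lia.
  apply/mem_dom;
  exists (colfun k.-1 (fun i => if i is i'.+1 then entry x i' else 0)).
  apply/memS => i ik.
  rewrite entry_colfun.
  case: ltnP => // ki; case: i ik ki => // i ik ki.
  by rewrite (_ : i = k.-2) ?h //; lia.
move=> j; split=> [l|||] /=.
- by rewrite /Wk rc0 !addv0 !(nul_exprel_eq0 (nul0 l)) qdimvv.
- by rewrite /Ak rc0 !addv0 !(mul_exprel_eq0 mul0) qdimvv.
- by rewrite /Bk rc0 !capv0 qdimvv.
rewrite /Ck r0 !addv0 addn0; case: eqP => [[->]|_]; last first.
  by rewrite !ranS /qdim !dim_coordsp !count_geq; lia.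
(* The constraints defining the domain and the range concern the coordinates
   k - 2 and 0. When these differ, the two spaces span everything. When
   k = 2 they coincide and both spaces are zero, as is the whole space when
   k is 0 or 1. *)
have [k3|k3] := ltnP 2 k.
  have -> : (ran S + dom S)%VS = fullv.
    apply/vspaceP => x; rewrite memvf.
    pose z : 'cV[K]_k.-1 :=
      colfun k.-1 (fun i => if i == 0%N then entry x 0 else 0).
    have zE i : entry z i = if i == 0%N then entry x 0 else 0.
      by rewrite entry_colfun; case: ifP => //; case: eqP => // -> ; lia.
    have zd : z \in dom S by apply/domS; rewrite zE; case: eqP => // ?; lia.
    suff xz : x - z \in ran S by rewrite -[x](subrK z) memv_add.
    rewrite ran1; apply/mem_coordsp => -[|i] // ik _.
    by rewrite -scaleN1r entryD entryZ zE eqxx mulN1r subrr.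
  rewrite ran1 /qdim dim_coordsp count_geq dimvf /dim /= muln1; lia.
have -> : dom S = 0%VS.
  apply/vspaceP => x; rewrite memv0; apply/idP/eqP => [/domS h|->]; last exact: mem0v.
  by apply/entryP => i ik; rewrite entry0 (_ : i = k.-2) //; lia.
by rewrite addv0 qdimvv.
Qed.

Lemma mem_graph n (M : 'M[K]_n) l k x y :
  ((x, y) \in exprel (shiftrel (kerrep 1%:M M) l) k) =
  ((M - l%:M) ^+ k *m x == y).
Proof.
elim: k x y => [|k IH] x y; first by rewrite expr0 mul1mx mem_idrel.
apply/mem_mulrel/eqP => [[z]|<-].
  rewrite IH mem_shiftrel mem_kerrep mul1mx -subr_eq => -[/eqP<- /eqP<-].
  by rewrite exprS -mulmxA -mul_scalar_mx -mulmxBl.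
exists ((M - l%:M) ^+ k *m x); rewrite IH mem_shiftrel mem_kerrep mul1mx.
by rewrite -subr_eq exprS -[_ * _ *m x]mulmxA -mul_scalar_mx -mulmxBl.
Qed.

Lemma mul_graph n (M : 'M[K]_n) : mul (kerrep 1%:M M) = 0%VS.
Proof.
by apply/vspaceP => y; rewrite memv0 mem_mul mem_kerrep mulmx0 mul1mx eq_sym.
Qed.

Lemma rootsp_c_graph n (M : 'M[K]_n) : rootsp_c (kerrep 1%:M M) = 0%VS.
Proof. by rewrite /rootsp_c (rootsp_inf_eq0 (mul_graph M)) capv0. Qed.

Lemma nul_graph n (M : 'M[K]_n) l k :
  nul (exprel (shiftrel (kerrep 1%:M M) l) k) = nulmx ((M - l%:M) ^+ k).
Proof. by apply/vspaceP => x; rewrite mem_nul mem_graph mem_nulmx. Qed.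

Lemma Wk_graph n (M : 'M[K]_n) l k : Wk (kerrep 1%:M M) l k = wk M l k.
Proof. by rewrite /Wk /wk rootsp_c_graph !addv0 !nul_graph. Qed.

Lemma nulmx_eq0 n (A : 'M[K]_n) : (nulmx A == 0%VS) = (A \in unitmx).
Proof.
apply/eqP/idP => [A0|uA]; last first.
  apply/vspaceP => x; rewrite mem_nulmx memv0.
  by apply/eqP/eqP => [h|->]; rewrite ?mulmx0 // -[x](mulKmx uA) h mulmx0.
rewrite -unitmx_tr -row_free_unit -kermx_eq0; apply/eqP/row_matrixP => i.
rewrite row0; apply: trmx_inj; rewrite trmx0.
have : (row i (kermx A^T))^T \in nulmx A.
  rewrite mem_nulmx; apply/eqP/trmx_inj.
  by rewrite trmx_mul trmxK -row_mul mulmx_ker row0 trmx0.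
by rewrite A0 memv0 => /eqP.
Qed.

Lemma nulmx_Nblock k j :
  nulmx (Nblock K k ^+ j) = coordsp K k (fun i => k <= i + j)%N.
Proof.
elim: j => [|j IH]; apply/vspaceP => x.
  rewrite expr0 mem_nulmx mul1mx coordsp0 ?memv0 // => i ik.
  by rewrite addn0 -ltnNge.
rewrite mem_nulmx exprSr -[_ * _ *m x]mulmxA -mem_nulmx IH.
apply/idP/idP => /mem_coordsp h; apply/mem_coordsp => i ik; rewrite -ltnNge => ij.
  by have := h i.+1; rewrite entry_Nblock ifT => [->|] //; lia.
by rewrite entry_Nblock ik; case: i ik ij => // i ik ij; apply: h; lia.
Qed.

(** For l different from the eigenvalue, J - l is injective, as the equation
(J - l) x = 0 determines the coordinates of x one after the other. For [Ck],
either the eigenvalue is 0 and the root space at 0 is everything, or J is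
invertible and the ranges are everything. *)
Lemma has_weyr_Jblock (t : K * nat) :
  has_weyr (kerrep 1%:M (Jblock t)) [:: t] [::] [::] [::].
Proof.
case: t => l0 k; set S := kerrep _ _.
have nul0 l : l != l0 -> nul (shiftrel S l) = 0%VS.
  move=> ll0; apply/vspaceP => x; rewrite memv0 mem_nul mem_shiftrel add0r.
  rewrite mem_kerrep mul1mx; apply/eqP/eqP => [|->]; last by rewrite mulmx0 scaler0.
  rewrite mulmxDl mul_scalar_mx /= => /entryP h; apply/entryP.
  elim=> [|i IH] ik; have := h _ ik; rewrite entryD !entryZ entry_Nblock ik.
    rewrite addr0 entry0 => /eqP; rewrite -subr_eq0 -mulrBl mulf_eq0.
    by rewrite subr_eq0 eq_sym (negPf ll0) => /eqP.
  rewrite IH ?(ltnW ik) // !entry0 addr0 => /eqP; rewrite -subr_eq0 -mulrBl mulf_eq0.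
  by rewrite subr_eq0 eq_sym (negPf ll0) => /eqP.
have nulS j :
    nul (exprel (shiftrel S l0) j) = coordsp K k (fun i => k <= i + j)%N.
  by rewrite nul_graph -nulmx_Nblock /Jblock /= addrAC subrr add0r.
move=> j; split=> [l|||] /=.
- rewrite /Wk rootsp_c_graph !addv0 eq_sym; case: eqP => [->|/eqP ll0].
    by rewrite !nulS /qdim !dim_coordsp !count_shift /=; lia.
  by rewrite !(nul_exprel_eq0 (nul0 _ ll0)) qdimvv.
- by rewrite /Ak rootsp_c_graph !addv0 !(mul_exprel_eq0 (mul_graph _)) qdimvv.
- by rewrite /Bk rootsp_c_graph !capv0 qdimvv.
have [l00|l00] := eqVneq 0 l0.
  have r0 : rootsp S 0 = fullv.
    apply/vspaceP => x; rewrite memvf; apply/mem_rootsp; exists k.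
    by rewrite l00 nulS coordsp_full ?memvf // => i _; exact: leq_addl.
  by rewrite /Ck r0 !addv_full !qdimvf; case: ifP.
have uJ : Jblock (l0, k) \in unitmx.
  rewrite -nulmx_eq0 -[Jblock _]expr1 -[Jblock _]subr0 -(rmorph0 scalar_mx).
  by rewrite -nul_graph exprel1 nul0.
have ranS : ran S = fullv.
  apply/vspaceP => y; rewrite memvf; apply/mem_ran.
  by exists (invmx (Jblock (l0, k)) *m y); rewrite mem_kerrep mul1mx mulKVmx.
by rewrite /Ck ranS !(ran_exprel_full ranS) !add_fullv !qdimvv; case: ifP.
Qed.

End Blocks.

(** * From the blocks to the Kronecker canonical form *)

Section Kronecker.
Variable K : fieldType.

Lemma has_weyr_bdiag (T : Type) (r c : T -> nat)
    (BE BF : forall t, 'M[K]_(r t, c t)) (s : seq T) J a b d :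
  (forall t, has_weyr (kerrep (BE t) (BF t)) (J t) (a t) (b t) (d t)) ->
  has_weyr (kerrep (bdiag BE s) (bdiag BF s)) (flatten (map J s))
    (flatten (map a s)) (flatten (map b s)) (flatten (map d s)).
Proof.
move=> h; elim: s => [|t s IH] /=; last exact: has_weyr_diag2.
by apply: has_weyr_dim0; rewrite dimvf.
Qed.

(** The matrices [E] and [F] are the coefficients of a pencil of polynomials. *)
Lemma pencil_inj n m :
  injective (fun p : 'M[K]_(n, m) * 'M[K]_(n, m) => pencil p.1 p.2).
Proof.
move=> [E F] [E' F'] /= /matrixP h; congr pair; apply/matrixP => i j.
  have /(congr1 (fun p : {poly K} => p`_1)) := h i j.
  by rewrite !mxE !coefB !coefXM !coefC /= !subr0.
have /(congr1 (fun p : {poly K} => p`_0)) := h i j.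
by rewrite !mxE !coefB !coefXM !coefC /= !sub0r => /oppr_inj.
Qed.

Lemma pencil_equiv n m (E F : 'M[K]_(n, m)) (V : 'M_n) (U : 'M_m) :
  map_mx polyC V *m pencil E F *m map_mx polyC U =
  pencil (V *m E *m U) (V *m F *m U).
Proof.
by rewrite /pencil mulmxBr mulmxBl -scalemxAr -scalemxAl !map_mxM.
Qed.

Lemma pencil_diag2 n1 m1 n2 m2 (E1 F1 : 'M[K]_(n1, m1))
    (E2 F2 : 'M[K]_(n2, m2)) :
  diag2 (pencil E1 F1) (pencil E2 F2) = pencil (diag2 E1 E2) (diag2 F1 F2).
Proof.
rewrite /pencil /diag2 !map_block_mx !map_mx0 scale_block_mx opp_block_mx.
by rewrite add_block_mx !scaler0 !oppr0 !addr0.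
Qed.

Lemma bdiag1 (T : Type) (r : T -> nat) s :
  1%:M = bdiag (fun t => 1%:M : 'M[K]_(r t)) s.
Proof.
by elim: s => [|t s IH] /=; [apply/matrixP=> -[] | rewrite -IH /diag2 -scalar_mx_block].
Qed.

Lemma tr_bdiag (T : Type) (r c : T -> nat) (B : forall t, 'M[K]_(r t, c t)) s :
  (bdiag B s)^T = bdiag (fun t => (B t)^T) s.
Proof.
elim: s => [|t s IH] /=; first by rewrite trmx0.
by rewrite /diag2 tr_block_mx !trmx0 IH.
Qed.

Lemma has_weyr_jordan J : has_weyr (kerrep 1%:M (@jordan K J)) J [::] [::] [::].
Proof.
rewrite (bdiag1 snd J).
have := has_weyr_bdiag J (@has_weyr_Jblock K).
have e T : flatten [seq ([::] : seq T) | _ <- J] = [::] by elim: (J).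
have -> : flatten [seq [:: t] | t <- J] = J by elim: {e} J => //= t J ->.
by rewrite !e.
Qed.

Lemma has_weyr_kronecker J a b c :
  has_weyr (kerrep
      (diag2 1%:M (diag2 (Nmx K a) (diag2 (Kmx K b) (Kmx K c)^T)))
      (diag2 (jordan J) (diag2 1%:M (diag2 (Lmx K b) (Lmx K c)^T))))
    J a b c.
Proof.
have e0 (T U : Type) (s : seq U) : flatten [seq ([::] : seq T) | _ <- s] = [::].
  by elim: s.
have e1 (T : Type) (s : seq T) : flatten [seq [:: t] | t <- s] = s.
  by elim: s => //= t s ->.
have ha := has_weyr_bdiag a (@has_weyr_Nblock K).
have hb := has_weyr_bdiag b (@has_weyr_KLblock K).
have hc := has_weyr_bdiag c (@has_weyr_KLblockT K).
rewrite !(e0, e1) in ha hb hc.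
rewrite -[J]cats0 -[a]cats0 -[b]cats0.
have := has_weyr_diag2 (has_weyr_jordan J)
  (has_weyr_diag2 ha (has_weyr_diag2 hb hc)).
rewrite -!tr_bdiag -bdiag1 !cats0 !cat0s.
by [].
Qed.

Lemma kronecker_form_has_weyr n m (E F : 'M[K]_(n, m)) J a b c :
    kronecker_form E F J a b c ->
  has_weyr (kerrep E F) J a b c.
Proof.
case=> _ _ _ _ [V [U [en [em [uV uU]]]]].
have -> : kronecker J a b c = pencil
    (diag2 1%:M (diag2 (Nmx K a) (diag2 (Kmx K b) (Kmx K c)^T)))
    (diag2 (jordan J) (diag2 1%:M (diag2 (Lmx K b) (Lmx K c)^T))).
  by rewrite /kronecker !pencil_diag2.
subst n m; rewrite castmx_id pencil_equiv.
move/(@pencil_inj _ _ (_, _) (_, _)) => -[eE eF].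
exact: has_weyr_equiv uV uU eE eF (has_weyr_kronecker _ _ _ _).
Qed.

End Kronecker.

(** * Conjugate partitions *)

Section Sequences.

Lemma finseq_widen d e f : (forall k, (d < k)%N -> f k = 0%N) ->
  finseq (d + e) f = finseq d f.
Proof.
move=> h; rewrite /finseq iotaD map_cat filter_cat -[RHS]cats0; congr (_ ++ _).
apply/eqP; rewrite -(negbK (_ == _)) -has_filter; apply/hasPn => x.
case/mapP=> k; rewrite mem_iota => /andP[k1 _] ->.
by rewrite h ?eqxx //; lia.
Qed.

Lemma eq_finseq d e f g : (forall k, f k.+1 = g k.+1) ->
  (forall k, (d < k)%N -> f k = 0%N) -> (forall k, (e < k)%N -> g k = 0%N) ->
  finseq d f = finseq e g.
Proof.
move=> fg hf hg; rewrite -(finseq_widen e hf) -(finseq_widen d hg) addnC.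
rewrite /finseq; congr filter; apply/eq_in_map => -[|k]; last by rewrite fg.
by rewrite mem_iota.
Qed.

Lemma sumn_finseq d f : sumn (finseq d f) = (\sum_(1 <= k < d.+1) f k)%N.
Proof.
rewrite sumnE big_filter big_mkcond big_map /index_iota subn1 /=.
by apply: eq_bigr => k _; case: eqP.
Qed.

Lemma count_leq_out (a : seq nat) k : (\max_(x <- a) x < k)%N ->
  count (leq k) a = 0%N.
Proof.
move=> h; apply/eqP; rewrite -leqn0 leqNgt -has_count; apply/hasPn => x xa.
by rewrite -ltnNge (leq_ltn_trans _ h) // (@leq_bigmax_seq _ _ xpredT id).
Qed.

Lemma conjpart_eq (a : seq nat) d f :
  (forall k, f k.+1 = count (leq k.+1) a) ->
  (forall k, (d < k)%N -> f k = 0%N) -> finseq d f = conjpart a.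
Proof. by move=> fa fd; apply: eq_finseq => // k; apply: count_leq_out. Qed.

Lemma sum_count_leq a d : all (fun x => x <= d)%N a ->
  (\sum_(1 <= k < d.+1) count (leq k) a)%N = sumn a.
Proof.
elim: a => [|x a IH] /=; first by rewrite big1.
case/andP=> xd /IH<-; rewrite big_split /=; congr addn.
elim: d x xd {IH} => [|e IH] x; first by rewrite leqn0 => /eqP->; rewrite big_geq.
rewrite big_nat_recr //= leq_eqVlt => /predU1P[->|xe]; last by rewrite IH //; lia.
rewrite leqnn -[RHS]addn1; congr addn.
rewrite -[RHS](IH e (leqnn e)); apply: eq_big_nat => k; lia.
Qed.

(** Both sides count the cells of the Young diagram, by columns and by rows. *)
Lemma sumn_conjpart a : sumn (conjpart a) = sumn a.
Proof.
rewrite sumn_finseq sum_count_leq //.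
by apply/allP => x xa; rewrite (@leq_bigmax_seq _ _ xpredT id).
Qed.

(** Removing two cells from each row of a Young diagram removes its first two
columns. *)
Lemma conjpart_cons a : 0%N \notin a ->
  conjpart a = [seq x <- [:: size a, count (leq 2) a
    & conjpart [seq (x - 2)%N | x <- a]] | x != 0%N].
Proof.
move=> a0; have [d dE] : exists d, \max_(x <- a) x = d by eexists.
have -> : conjpart a = finseq d.+2 (fun k => count (leq k) a).
  apply: eq_finseq => // k h; apply: count_leq_out; first exact: h.
  by rewrite dE; lia.
have -> : conjpart [seq (x - 2)%N | x <- a] =
    finseq d (fun k => count (leq k.+2) a).
  apply/esym/conjpart_eq => k; last by move=> h; apply: count_leq_out; rewrite dE; lia.
  by rewrite count_map; apply: eq_count => x /=; lia.
have -> : size a = count (leq 1) a.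
  apply/esym/eqP; rewrite -all_count; apply/allP => x xa.
  by rewrite lt0n; apply: contraNneq a0 => <-.
rewrite /finseq /= (iotaDl 2 1) -map_comp filter_id.
by [].
Qed.

Lemma sorted_conjpart a : sorted geq (conjpart a).
Proof.
apply: sorted_filter; first by move=> x y z; exact: (rev_trans leq_trans).
rewrite sorted_map.
apply: (sub_sorted _ (iota_sorted 1 _)) => x y xy /=.
by apply: sub_count => z; exact: leq_trans.
Qed.

Lemma head_conjpart a : 0%N \notin a -> head 0%N (conjpart a) = size a.
Proof.
case: a => [_|x a /conjpart_cons->] //.
by rewrite /conjpart big_nil.
Qed.

(** In a non-increasing sequence of natural numbers all zeros are at the end. *)
Lemma omit_trailing0_sorted (s : seq nat) : sorted geq s ->
  omit_trailing0 [seq k%:Z | k <- s] = [seq k%:Z | k <- s & k != 0%N].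
Proof.
move=> hs; rewrite /omit_trailing0 -map_rev -map_drop -map_rev; congr map.
rewrite find_map -[in RHS](revK s) filter_rev; congr rev.
have: sorted leq (rev s) by rewrite rev_sorted.
elim: (rev s) => //= x t IH; case: x => [|x] /= hx; last first.
  congr cons; apply/esym/all_filterP/allP => y yt.
  move: hx; rewrite path_sortedE; last exact: leq_trans.
  by case/andP=> /allP/(_ y yt); case: y {yt}.
by apply: IH; apply: path_sorted hx.
Qed.

Lemma sumn_predn (a : seq nat) : 0%N \notin a ->
  (sumn (map predn a) + size a = sumn a)%N.
Proof.
elim: a => //= x a IH; rewrite inE negb_or => /andP[x0 /IH<-].
by case: x x0 => // x _ /=; lia.
Qed.

Lemma sumn_predn2 (a : seq nat) :
  (sumn (map predn a) = count (leq 2) a + sumn [seq (x - 2)%N | x <- a])%N.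
Proof. by elim: a => //= x a ->; lia. Qed.

End Sequences.

(** * Eigenvalues *)

Section Spectrum.
Variable K : fieldType.

Lemma sumn_by_eigenvalue (T : choiceType) (J : seq (T * nat)) :
  (\sum_(l <- undup (map fst J)) sumn [seq t.2 | t <- J & t.1 == l] =
   sumn (map snd J))%N.
Proof.
rewrite sumnE big_map.
under eq_bigr do rewrite sumnE big_map big_filter.
rewrite (exchange_big_dep xpredT) //= big_seq [RHS]big_seq.
apply: eq_bigr => t tJ; rewrite -big_filter.
rewrite (_ : [seq _ <- _ | _] = [:: t.1]) ?big_seq1 //.
rewrite (eq_filter (a2 := pred1 t.1)) => [|l]; last exact: eq_sym.
by rewrite filter_pred1_uniq ?undup_uniq // mem_undup map_f.
Qed.

(** Without an eigenvector for [l] the root space is zero, so [l] is proper exactly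
when the root space exceeds [rootsp_c], that is, when one of the kernels that
exhaust the root space does. *)
Lemma proper_eigenvalueP (X : vectType K) (S : {vspace X * X}) l :
  proper_eigenvalue S l <-> exists k, Wk S l k.+1 <> 0%N.
Proof.
have -> : proper_eigenvalue S l = ~~ (rootsp S l <= rootsp_c S)%VS.
  rewrite /proper_eigenvalue /releigenvalue.
  have [h|//] := eqVneq (nul (shiftrel S l)) 0%VS.
  by rewrite rootsp_eq0 // sub0v.
split=> [|[k h]]; last first.
  apply/negP => s; apply: h; rewrite /Wk.
  have e j : (nul (exprel (shiftrel S l) j) + rootsp_c S)%VS = rootsp_c S.
    apply/addv_idPr; apply: subv_trans s; apply/subvP => x xj.
    by apply/mem_rootsp; exists j.
  by rewrite !e qdimvv.
have [/forallP h|] := boolP [forall k : 'I_(\dim {:X}), Wk S l k.+1 == 0%N];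
  last by rewrite negb_forall => /existsP[k hk] _; exists k; exact/eqP.
have {}h k : Wk S l k.+1 = 0%N.
  have [kX|kX] := ltnP k (\dim {:X}); first exact/eqP/(h (Ordinal kX)).
  by rewrite Wk_eq0.
case/negP; apply/subvP => x /mem_rootsp[k xk].
suff e : (nul (exprel (shiftrel S l) k) + rootsp_c S)%VS = rootsp_c S.
  by rewrite -e (subvP (addvSl _ _)).
elim: k {xk} => [|k IH]; first by rewrite nul_exprel0 add0v.
rewrite -[RHS]IH; apply/esym/eqP; rewrite eqEdim addvS ?nul_exprel_sub //=.
by rewrite -subn_eq0 -/(qdim _ _); apply/eqP; exact: h.
Qed.

Lemma eigenvalue_nulmx n (M : 'M[K]_n) l :
  eigenvalue M l = (nulmx (M - l%:M) != 0%VS).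
Proof. by rewrite nulmx_eq0 /eigenvalue kermx_eq0 row_free_unit. Qed.

(** The graph of a matrix is single-valued, so that [rootsp_c] is zero and every
eigenvalue is proper. *)
Lemma proper_eigenvalue_graph n (M : 'M[K]_n) l :
  proper_eigenvalue (kerrep 1%:M M) l = eigenvalue M l.
Proof.
rewrite eigenvalue_nulmx -(expr1 (M - _)) -nul_graph exprel1.
rewrite /proper_eigenvalue /releigenvalue rootsp_c_graph subv0.
case: eqP => //= /eqP; apply: contraNneq => h.
rewrite -subv0 -h; apply/subvP => x; rewrite -{1}[shiftrel _ _]exprel1 => xS.
by apply/mem_rootsp; exists 1%N.
Qed.

Lemma proper_has_weyr (X : vectType K) (S : {vspace X * X}) J a b c l :
  0%N \notin map snd J -> has_weyr S J a b c ->
  proper_eigenvalue S l = (l \in map fst J).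
Proof.
move=> J0 h; have W k : Wk S l k.+1 =
    count (fun t => (t.1 == l) && (k < t.2))%N J by have [->] := h k.
apply/idP/mapP => [/proper_eigenvalueP[k]|[t tJ lt]]; last first.
  apply/proper_eigenvalueP; exists 0%N; rewrite W; apply/eqP.
  rewrite -lt0n -has_count; apply/hasP.
  exists t; rewrite // lt eqxx lt0n; apply: contraNneq J0 => <-.
  exact: map_f.
rewrite W => /eqP; rewrite -lt0n -has_count => /hasP[t tJ /andP[/eqP<- _]].
by exists t.
Qed.

Lemma sizeW_has_weyr (X : vectType K) (S : {vspace X * X}) J a b c :
  0%N \notin map snd J -> has_weyr S J a b c -> sizeW S = sumn (map snd J).
Proof.
move=> J0 h; rewrite -sumn_by_eigenvalue fsbig_seq ?undup_uniq // /sizeW.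
rewrite (_ : [set l | proper_eigenvalue S l]%classic =
             [set` undup (map fst J)]%classic); last first.
  by apply/seteqP; split=> l /=; rewrite mem_undup (proper_has_weyr l J0 h).
apply: eq_fsbigr => l _; rewrite -[RHS]sumn_conjpart; congr sumn.
apply: conjpart_eq => k; last exact: Wk_eq0.
have [-> _ _ _] := h k.
rewrite count_map count_filter; apply: eq_count => t /=.
by rewrite andbC.
Qed.

End Spectrum.

(** * The Weyr characteristic of the pencil *)

Theorem proposition5p2 (R : realType) (m : nat)
    (S : {vspace 'cV[R[i]]_m * 'cV[R[i]]_m})
    (n : nat) (E F : 'M[R[i]]_(n, m)) (hS : kerrep E F = S)
    (J : seq (R[i] * nat)) (alpha beta gamma : seq nat)
    (hK : kronecker_form E F J alpha beta gamma) :
  [/\ (forall l : R[i], proper_eigenvalue S l = eigenvalue (jordan J) l) /\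
      (forall l : R[i], eigenvalue (jordan J) l ->
         weyrmx (jordan J) l = weyrW S l),
      conjpart alpha = weyrA S,
      conjpart beta = weyrB S &
      [seq k%:Z | k <- conjpart gamma] =
      omit_trailing0
        [:: n%:Z - m%:Z + (head 0%N (weyrB S))%:Z,
            m%:Z - (sizeW S)%:Z - (sumn (weyrA S))%:Z - (sumn (weyrB S))%:Z
              - (sumn (weyrC S))%:Z
          & [seq k%:Z | k <- weyrC S]]].
Proof.
have := kronecker_form_has_weyr hK; rewrite hS => hw.
have hj := has_weyr_jordan J.
case: hK => J0 [_ a0] [_ b0] [_ c0] [_ [_ [en [em _]]]].
rewrite !map_id in en em.
have {}en : n = (sumn (map snd J) + (sumn alpha +
    (sumn (map predn beta) + sumn gamma)))%N := en.
have {}em : m = (sumn (map snd J) + (sumn alpha +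
    (sumn beta + sumn (map predn gamma))))%N := em.
have eA : weyrA S = conjpart alpha.
  by apply: conjpart_eq => k; [have [] := hw k | exact: Ak_eq0].
have eB : weyrB S = conjpart beta.
  by apply: conjpart_eq => k; [have [] := hw k | exact: Bk_eq0].
have eC : weyrC S = conjpart [seq (x - 2)%N | x <- gamma].
  apply: conjpart_eq => k; last exact: Ck_eq0.
  have [_ _ _ ->] := hw k; rewrite count_map.
  by apply: eq_count => x /=; lia.
split=> //.
  split=> l.
    rewrite -proper_eigenvalue_graph (proper_has_weyr l J0 hw).
    by rewrite (proper_has_weyr l J0 hj).
  move=> _; apply: eq_finseq => k; [|exact: wk_eq0|exact: Wk_eq0].
  by rewrite -Wk_graph; have [-> _ _ _] := hw k; have [-> _ _ _] := hj k.
rewrite eA eB eC (sizeW_has_weyr J0 hw) !sumn_conjpart head_conjpart //.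
rewrite conjpart_cons //.
(* Each block s K - L has one column more than rows, each transposed block one
   row more than columns, and all other blocks are square. *)
have -> : n%:Z - m%:Z + (size beta)%:Z = (size gamma)%:Z.
  by have := sumn_predn b0; have := sumn_predn c0; lia.
(* A transposed block of parameter k has k - 1 columns and contributes k - 2
   (or 0 if k = 1) to the sum of C. The difference is 1 exactly if k >= 2. *)
have -> : m%:Z - (sumn (map snd J))%:Z - (sumn alpha)%:Z - (sumn beta)%:Z -
    (sumn [seq (x - 2)%N | x <- gamma])%:Z = (count (leq 2) gamma)%:Z.
  by have := sumn_predn2 gamma; lia.
(* The entries of C are counts over smaller sets than the second entry. *)
rewrite -omit_trailing0_sorted //= count_size path_sortedE /=; last first.
  by move=> x y z; exact: (rev_trans leq_trans).
rewrite sorted_conjpart andbT; apply/allP => x.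
rewrite mem_filter => /andP[_ /mapP[k]]; rewrite mem_iota => /andP[k1 _] ->.
by rewrite count_map; apply: sub_count => y /=; lia.
Qed.
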